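(* Let $(M,g)$ be a Riemannian manifold of dimension $n\geq 4$ and let $f$ be a smooth real-valued function on $M$. Then the second Gauss–Bonnet curvatures $h_4$ of $g$ and $\bar h_4$ of the conformal metric $\bar g=e^{2f}g$ are related by $$e^{4f}\,\bar h_4=h_4+\mathcal L_g(f),$$ where $\mathcal L_g$ is the second order fully nonlinear differential operator $$\begin{aligned}\mathcal L_g(f)=\;&2(n-2)(n-3)\,\sigma_2(\mathrm{Hess}\,f)+2(n-3)\,\ell_2(f)-(n-2)(n-3)^2\,\Delta f\,|df|^2\\&+2(n-2)(n-3)\,\mathrm{Hess}\,f(\nabla f,\nabla f)+2(n-3)\,T_2(\nabla f,\nabla f)\\&-(n-2)(n-3)\,h_2\,|df|^2+\frac{(n-1)(n-2)(n-3)(n-4)}{4}\,|df|^4 .\end{aligned}$$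
   Context: All unbarred quantities are taken with respect to $g$. $R$, $Ric$, $Scal$ denote the Riemann tensor, Ricci tensor and scalar curvature. $h_2=\frac12 Scal$. The second Gauss–Bonnet curvature is $h_4=|R|^2-|Ric|^2+\frac14Scal^2$, with $|R|^2=\sum_{i<j,\,k<l}R_{ijkl}^2$ in an orthonormal basis (a quarter of the full tensor norm squared) and $|Ric|^2=\sum_{i,j} Ric_{ij}^2$. $T_2=h_2\,g-Ric$ is the Einstein tensor. $\mathrm{Hess}\,f$ is the Hessian, $\Delta f=-\mathrm{trace}_g(\mathrm{Hess}\,f)$ (note the sign), $\sigma_2(\mathrm{Hess}\,f)$ is the second elementary symmetric function of the eigenvalues of $\mathrm{Hess}\,f$ with respect to $g$, and $\ell_2(f)=-\langle T_2,\mathrm{Hess}\,f\rangle$. *)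

(* Defs.v *)
From HB Require Import structures.
From mathcomp Require Import all_boot all_order all_algebra.
From mathcomp Require Import all_classical all_reals all_analysis.
Set Implicit Arguments.
Unset Strict Implicit.
Unset Printing Implicit Defensive.
Import Order.TTheory GRing.Theory Num.Theory.
Import numFieldNormedType.Exports.
Local Open Scope classical_set_scope.
Local Open Scope ring_scope.

Definition partial (R : realType) (n : nat) (i : 'I_n)
    (F : 'rV[R]_n -> R) (x : 'rV[R]_n) : R :=
  'D_(delta_mx 0 i) F x.

Definition iter_partial (R : realType) (n : nat) (s : seq 'I_n)
    (F : 'rV[R]_n -> R) : 'rV[R]_n -> R :=
  foldr (@partial R n) F s.

(* C^oo on an open set U: on U, all iterated partial derivatives exist and
   are continuous. *)
Definition smooth_on (R : realType) (n : nat) (U : set 'rV[R]_n)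
    (F : 'rV[R]_n -> R) : Prop :=
  forall (s : seq 'I_n) (x : 'rV[R]_n), U x ->
    {for x, continuous (iter_partial s F)} /\
    forall i : 'I_n, derivable (iter_partial s F) x (delta_mx 0 i).

(* Both maps are total; only the restrictions of [chart_map] to [chart_dom]
   and of [chart_inv] to [chart_cod] are meaningful. *)
Record chart (R : realType) (n : nat) (M : topologicalType) := Chart {
  chart_dom : set M;
  chart_map : M -> 'rV[R]_n;
  chart_inv : 'rV[R]_n -> M }.

Definition chart_cod (R : realType) (n : nat) (M : topologicalType)
    (c : chart R n M) : set 'rV[R]_n :=
  chart_map c @` chart_dom c.

Definition is_chart (R : realType) (n : nat) (M : topologicalType)
    (c : chart R n M) : Prop :=
  [/\ open (chart_dom c), open (chart_cod c),
      forall p, chart_dom c p -> chart_inv c (chart_map c p) = p,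
      forall p, chart_dom c p -> {for p, continuous (chart_map c)} &
      forall x, chart_cod c x -> {for x, continuous (chart_inv c)}].

Definition transition (R : realType) (n : nat) (M : topologicalType)
    (c d : chart R n M) (x : 'rV[R]_n) : 'rV[R]_n :=
  chart_map d (chart_inv c x).

Definition smooth_manifold (R : realType) (n : nat) (M : topologicalType)
    (A : set (chart R n M)) : Prop :=
  [/\ hausdorff_space M, @second_countable M,
      forall c, A c -> is_chart c,
      forall p : M, exists2 c, A c & chart_dom c p &
      forall c d, A c -> A d -> forall k : 'I_n,
        smooth_on (chart_map c @` (chart_dom c `&` chart_dom d))
                  (fun x => transition c d x 0 k)].

Definition smooth_function (R : realType) (n : nat) (M : topologicalType)
    (A : set (chart R n M)) (f : M -> R) : Prop :=
  forall c, A c -> smooth_on (chart_cod c) (fun x => f (chart_inv c x)).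

(* A tangent vector at p is given, in a chart c around p, by the row vector of
   its components in the coordinate basis d_1, ..., d_n.  A field of bilinear
   forms on the tangent spaces is given by its coordinate matrices:
   [g c p i j] stands for g_p(d_i, d_j) in the chart c. *)
Definition form_field (R : realType) (n : nat) (M : topologicalType) : Type :=
  chart R n M -> M -> 'M[R]_n.

(* [jacobian] acts on row vectors, so row i of ['J (transition c d) x] holds
   the components in d of the i-th coordinate vector of c; the last clause is
   the transformation law of a covariant 2-tensor. *)
Definition riemannian_metric (R : realType) (n : nat) (M : topologicalType)
    (A : set (chart R n M)) (g : form_field R n M) : Prop :=
  [/\ forall c, A c -> forall i j : 'I_n,
        smooth_on (chart_cod c) (fun x => g c (chart_inv c x) i j),
      forall c p, A c -> chart_dom c p -> (g c p)^T = g c p,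
      forall c p, A c -> chart_dom c p ->
        forall v : 'rV[R]_n, v != 0 -> 0 < (v *m g c p *m v^T) 0 0 &
      forall c d p, A c -> A d -> chart_dom c p -> chart_dom d p ->
        let J := 'J (transition c d) (chart_map c p) in
        g c p = J *m g d p *m J^T].

Definition conformal (R : realType) (n : nat) (M : topologicalType)
    (f : M -> R) (g : form_field R n M) : form_field R n M :=
  fun c p => expR (2 * f p) *: g c p.

Definition form_of (R : realType) (n : nat) (B : 'M[R]_n)
    (v w : 'rV[R]_n) : R :=
  (v *m B *m w^T) 0 0.

(* The rows of E form an orthonormal basis for the inner product [form_of G];
   the value 0 is never used when G is symmetric positive definite. *)
Definition orthonormal_basis (R : realType) (n : nat) (G : 'M[R]_n) : 'M[R]_n :=
  xget 0 [set E : 'M[R]_n | E *m G *m E^T = 1%:M].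

(* The eigenvalues, with multiplicity, of a matrix whose characteristic
   polynomial splits over R (always so for a G-self-adjoint endomorphism); the
   default value is used only when it does not split. *)
Definition eigenvalues (R : realType) (n : nat) (B : 'M[R]_n) : n.-tuple R :=
  xget [tuple 0 | i < n]
       [set s : n.-tuple R | char_poly B = \prod_(a <- s) ('X - a%:P)].

(* The eigenvalues of a symmetric form with matrix H with respect to G are
   those of the endomorphism S with G(S v, w) = H(v, w), i.e. v |-> v H G^-1
   on row vectors. *)
Definition sigma2 (R : realType) (n : nat) (G H : 'M[R]_n) : R :=
  \sum_(i < n) \sum_(j < n | (i < j)%N)
    tnth (eigenvalues (H *m invmx G)) i * tnth (eigenvalues (H *m invmx G)) j.

(* G : 'rV_n -> 'M_n is the coordinate expression of the metric. *)

(* Gamma^k_{ij}: the upper index comes first. *)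
Definition christoffel (R : realType) (n : nat) (G : 'rV[R]_n -> 'M[R]_n)
    (k i j : 'I_n) (x : 'rV[R]_n) : R :=
  2^-1 * \sum_(l < n) invmx (G x) k l *
    (partial i (fun y => G y j l) x + partial j (fun y => G y i l) x
     - partial l (fun y => G y i j) x).

(* The d_m-component of
   R(d_i, d_j) d_l = nabla_i nabla_j d_l - nabla_j nabla_i d_l. *)
Definition curvature_op (R : realType) (n : nat) (G : 'rV[R]_n -> 'M[R]_n)
    (m l i j : 'I_n) (x : 'rV[R]_n) : R :=
  partial i (christoffel G m j l) x - partial j (christoffel G m i l) x
  + \sum_(s < n) (christoffel G s j l x * christoffel G m i s x
                  - christoffel G s i l x * christoffel G m j s x).

(* The sign is such that R(u, v, u, v) is the sectional curvature of an
   orthonormal pair u, v: R_ijkl = g(R(d_i, d_j) d_l, d_k). *)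
Definition riemann_coord (R : realType) (n : nat) (G : 'rV[R]_n -> 'M[R]_n)
    (i j k l : 'I_n) (x : 'rV[R]_n) : R :=
  \sum_(m < n) curvature_op G m l i j x * G x m k.

Definition hessian_mx (R : realType) (n : nat) (G : 'rV[R]_n -> 'M[R]_n)
    (F : 'rV[R]_n -> R) (x : 'rV[R]_n) : 'M[R]_n :=
  \matrix_(i, j) (partial i (partial j F) x
                  - \sum_(k < n) christoffel G k i j x * partial k F x).

(* Below, c is a chart around p and tangent vectors at p are given by their
   components in c. *)

Definition in_chart (R : realType) (n : nat) (M : topologicalType) (T : Type)
    (c : chart R n M) (F : M -> T) : 'rV[R]_n -> T :=
  fun x => F (chart_inv c x).

Definition onb (R : realType) (n : nat) (M : topologicalType)
    (g : form_field R n M) (c : chart R n M) (p : M) (a : 'I_n) : 'rV[R]_n :=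
  row a (orthonormal_basis (g c p)).

Definition riemann (R : realType) (n : nat) (M : topologicalType)
    (g : form_field R n M) (c : chart R n M) (p : M)
    (u v w z : 'rV[R]_n) : R :=
  \sum_(i < n) \sum_(j < n) \sum_(k < n) \sum_(l < n)
    u 0 i * v 0 j * w 0 k * z 0 l *
    riemann_coord (in_chart c (g c)) i j k l (chart_map c p).

Definition ricci (R : realType) (n : nat) (M : topologicalType)
    (g : form_field R n M) (c : chart R n M) (p : M) (v w : 'rV[R]_n) : R :=
  \sum_(a < n) riemann g c p (onb g c p a) v (onb g c p a) w.

Definition scal (R : realType) (n : nat) (M : topologicalType)
    (g : form_field R n M) (c : chart R n M) (p : M) : R :=
  \sum_(a < n) ricci g c p (onb g c p a) (onb g c p a).

Definition riemann_sqnorm (R : realType) (n : nat) (M : topologicalType)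
    (g : form_field R n M) (c : chart R n M) (p : M) : R :=
  let e := onb g c p in
  \sum_(i < n) \sum_(j < n | (i < j)%N) \sum_(k < n) \sum_(l < n | (k < l)%N)
    riemann g c p (e i) (e j) (e k) (e l) ^+ 2.

Definition ricci_sqnorm (R : realType) (n : nat) (M : topologicalType)
    (g : form_field R n M) (c : chart R n M) (p : M) : R :=
  let e := onb g c p in
  \sum_(i < n) \sum_(j < n) ricci g c p (e i) (e j) ^+ 2.

Definition h2 (R : realType) (n : nat) (M : topologicalType)
    (g : form_field R n M) (c : chart R n M) (p : M) : R :=
  scal g c p / 2.

Definition h4 (R : realType) (n : nat) (M : topologicalType)
    (g : form_field R n M) (c : chart R n M) (p : M) : R :=
  riemann_sqnorm g c p - ricci_sqnorm g c p + scal g c p ^+ 2 / 4.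

Definition T2 (R : realType) (n : nat) (M : topologicalType)
    (g : form_field R n M) (c : chart R n M) (p : M) (v w : 'rV[R]_n) : R :=
  h2 g c p * form_of (g c p) v w - ricci g c p v w.

Definition differential (R : realType) (n : nat) (M : topologicalType)
    (f : M -> R) (c : chart R n M) (p : M) : 'rV[R]_n :=
  \row_i partial i (in_chart c f) (chart_map c p).

(* g(grad f, w) = df(w) *)
Definition gradient (R : realType) (n : nat) (M : topologicalType)
    (g : form_field R n M) (f : M -> R) (c : chart R n M) (p : M) : 'rV[R]_n :=
  differential f c p *m invmx (g c p).

Definition differential_sqnorm (R : realType) (n : nat) (M : topologicalType)
    (g : form_field R n M) (f : M -> R) (c : chart R n M) (p : M) : R :=
  \sum_(a < n) (differential f c p *m (onb g c p a)^T) 0 0 ^+ 2.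

Definition Hess (R : realType) (n : nat) (M : topologicalType)
    (g : form_field R n M) (f : M -> R) (c : chart R n M) (p : M) : 'M[R]_n :=
  hessian_mx (in_chart c (g c)) (in_chart c f) (chart_map c p).

Definition Laplacian (R : realType) (n : nat) (M : topologicalType)
    (g : form_field R n M) (f : M -> R) (c : chart R n M) (p : M) : R :=
  - \sum_(a < n) form_of (Hess g f c p) (onb g c p a) (onb g c p a).

Definition sigma2_Hess (R : realType) (n : nat) (M : topologicalType)
    (g : form_field R n M) (f : M -> R) (c : chart R n M) (p : M) : R :=
  sigma2 (g c p) (Hess g f c p).

Definition ell2 (R : realType) (n : nat) (M : topologicalType)
    (g : form_field R n M) (f : M -> R) (c : chart R n M) (p : M) : R :=
  let e := onb g c p in
  - \sum_(a < n) \sum_(b < n)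
      T2 g c p (e a) (e b) * form_of (Hess g f c p) (e a) (e b).

Definition conformal_operator (R : realType) (n : nat) (M : topologicalType)
    (g : form_field R n M) (f : M -> R) (c : chart R n M) (p : M) : R :=
  let N : R := n%:R in
  let grad := gradient g f c p in
  let df2 := differential_sqnorm g f c p in
  2 * (N - 2) * (N - 3) * sigma2_Hess g f c p
  + 2 * (N - 3) * ell2 g f c p
  - (N - 2) * (N - 3) ^+ 2 * Laplacian g f c p * df2
  + 2 * (N - 2) * (N - 3) * form_of (Hess g f c p) grad grad
  + 2 * (N - 3) * T2 g c p grad grad
  - (N - 2) * (N - 3) * h2 g c p * df2
  + (N - 1) * (N - 2) * (N - 3) * (N - 4) / 4 * df2 ^+ 2.

(* Main.v *)
Require Import Defs.
From HB Require Import structures.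
From mathcomp Require Import all_boot all_order all_algebra.
From mathcomp Require Import all_classical all_reals all_analysis.
From mathcomp Require Import complex spectral.
From mathcomp Require Import ring.
Set Implicit Arguments.
Unset Strict Implicit.
Unset Printing Implicit Defensive.
Import Order.TTheory GRing.Theory Num.Theory.
Import numFieldNormedType.Exports.
Local Open Scope classical_set_scope.
Local Open Scope ring_scope.

(** Fix a chart.  Everything rests on the conformal change of the Riemann
    tensor,
      [Rbar = e^(2f) (Riem - g . A)],  [A = Hess f - df (x) df + |df|^2/2 g],
    where [.] is the Kulkarni-Nomizu product ([conformal_riemann]).  It is
    obtained from the expression of the fully covariant curvature through
    Christoffel symbols of the first kind ([riemann_first_kind]): there only
    first derivatives of [g] are differentiated, never [g^-1], and under
    [g -> e^(2f) g] these symbols change by an explicit expression in [df] and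
    [g].  The symmetry of second derivatives ([derive_commute]) gives both the
    symmetry of [Hess f] and the antisymmetry of [Riem] in its last two indices
    ([riemann_antisym]).

    In an orthonormal frame [h_4] is a quadratic form in the components of the
    curvature ([gauss_bonnet4]) and does not depend on the frame
    ([gauss_bonnet4_frame_indep]).  A [gbar]-orthonormal frame times [e^f] is
    [g]-orthonormal, which accounts for the factor [e^(4f)] and leaves
    [h_4 (Riem - g . A)] to compute.  Since [<R, g . A> = <Ric R, A>] for every
    [R] antisymmetric in both pairs ([kulkarni_nomizu_pairing]), the cross term
    is [-2(n-3) <T_2, A>], and taking [R = g . A] the quadratic term is
    [(n-2)(n-3) ((tr A)^2 - |A|^2)] ([gauss_bonnet4_sub_kulkarni_nomizu]).
    Expanding [A] yields the operator ([gauss_bonnet4_schouten]), once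
    [2 sigma_2(Hess f)] is recognised as [(tr S)^2 - tr S^2] for the matrix [S]
    of [Hess f] in an orthonormal frame; this last point is the spectral theorem
    for real symmetric matrices ([sigma2E]). *)

(** * Orthonormal bases and the second symmetric function *)

Lemma invmx_orthonormal (R : realType) (n : nat) (G E : 'M[R]_n) :
  E *m G *m E^T = 1%:M -> G \in unitmx /\ invmx G = E^T *m E.
Proof.
move=> EG; have [uEG _] := mulmx1_unit EG.
have [uE uG] : E \in unitmx /\ G \in unitmx by apply/andP; rewrite -unitmx_mul.
split=> //; have /(congr1 (mulmx (invmx E))) := EG.
rewrite mulmx1 -mulmxA mulKmx // => GET.
have /mulmx1C : G *m (E^T *m E) = 1%:M by rewrite mulmxA GET mulVmx.
by move=> inv; rewrite -[RHS](mulmxK uG) inv mul1mx.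
Qed.

(** Orthonormal families are extended one vector at a time: while there are
    fewer than [n] rows, the vectors orthogonal to all of them form a nonzero
    kernel, and positivity allows one of them to be normalised. *)
Lemma exists_orthonormal (R : realType) (n : nat) (G : 'M[R]_n) :
  G^T = G -> (forall v : 'rV[R]_n, v != 0 -> 0 < (v *m G *m v^T) 0 0) ->
  exists E : 'M[R]_n, E *m G *m E^T = 1%:M.
Proof.
move=> Gsym Gpos.
suff: forall k, (k <= n)%N -> exists E : 'M[R]_(k, n), E *m G *m E^T = 1%:M.
  by move=> /(_ n (leqnn n)).
elim=> [_|k IH kn]; first by exists 0; apply/matrixP => -[].
have [E EG] := IH (ltnW kn).
have : kermx (G *m E^T) != 0.
  rewrite -mxrank_eq0 mxrank_ker -lt0n subn_gt0.
  exact: leq_ltn_trans (rank_leq_col _) kn.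
move=> /rowV0Pn[v /sub_kermxP vE v0].
have vpos := Gpos _ v0; set q := _ 0 0 in vpos.
pose w := (Num.sqrt q)^-1 *: v.
have wE : w *m G *m E^T = 0 by rewrite -mulmxA -scalemxAl vE scaler0.
have Ew : E *m G *m w^T = 0.
  by apply: trmx_inj; rewrite !trmx_mul trmxK Gsym mulmxA wE trmx0.
have ww : w *m G *m w^T = 1%:M.
  apply/matrixP => i j; rewrite !ord1 /w linearZ /= -scalemxAr -!scalemxAl.
  rewrite 2!mxE -/q mxE eqxx mulrA -invfM -expr2 sqr_sqrtr ?ltW //.
  by rewrite mulVf // gt_eqF.
rewrite -addn1; exists (col_mx E w).
by rewrite mul_col_mx tr_col_mx mul_col_row EG Ew wE ww -scalar_mx_block.
Qed.

Lemma orthonormal_basisP (R : realType) (n : nat) (G : 'M[R]_n) :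
  G^T = G -> (forall v : 'rV[R]_n, v != 0 -> 0 < (v *m G *m v^T) 0 0) ->
  orthonormal_basis G *m G *m (orthonormal_basis G)^T = 1%:M.
Proof.
move=> Gsym Gpos; have [E EG] := exists_orthonormal Gsym Gpos.
exact: (@xgetPex _ 0 [set E : 'M[R]_n | E *m G *m E^T = 1%:M] (ex_intro _ E EG)).
Qed.

Lemma char_poly_conj (F : fieldType) (n : nat) (P B : 'M[F]_n) :
  P \in unitmx -> char_poly (P *m B *m invmx P) = char_poly B.
Proof.
move=> uP; rewrite /char_poly /char_poly_mx.
have -> : 'X%:M - map_mx polyC (P *m B *m invmx P)
   = map_mx polyC P *m ('X%:M - map_mx polyC B) *m map_mx polyC (invmx P).
  rewrite mulmxBr mulmxBl mul_mx_scalar -scalemxAl -!map_mxM mulmxV //.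
  by rewrite map_mx1 scalemx1.
by rewrite !det_mulmx mulrAC -det_mulmx -map_mxM mulmxV // map_mx1 det1 mul1r.
Qed.

(** Over [R[i]] a real symmetric matrix is unitarily diagonalisable with real
    eigenvalues; the identities for the traces are then read off the diagonal
    and descend to [R].  Only the eigenvalues are needed, so no real orthogonal
    diagonalisation is constructed. *)
Lemma symmetric_char_poly_splits (R : rcfType) (n : nat) (S : 'M[R]_n) :
  S^T = S ->
  exists d : 'I_n -> R,
    [/\ char_poly S = \prod_(i < n) ('X - (d i)%:P),
        \tr S = \sum_i d i & \tr (S *m S) = \sum_i d i ^+ 2].
Proof.
move=> Ssym; pose rc : {rmorphism R -> R[i]} := real_complex R.
pose C := map_mx rc S.
have Creal : C \is a mxOver Num.real.
  by apply/mxOverP => i j; rewrite mxE; apply/complex_realP; exists (S i j).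
have Csym : C \is symmetricmx.
  apply/is_hermitianmxP; rewrite expr0 scale1r map_mx_id //.
  by apply/matrixP => i j; rewrite !mxE -{1}Ssym mxE.
have Cherm := realsym_hermsym Csym Creal.
have /orthomx_spectralP Ceq := hermitian_normalmx Cherm.
have /mxOverP dreal := hermitian_spectral_diag_real Cherm.
have uP := spectral_unit C.
set P := spectralmx C in Ceq uP; set D := spectral_diag C in Ceq dreal.
pose d i := complex.Re (D 0 i).
have dE i : rc (d i) = D 0 i by apply: RRe_real; exact: dreal.
have rcI : injective rc by exact: complexI.
exists d; split.
- apply: (map_poly_inj rc); rewrite map_char_poly -/C Ceq.
  rewrite -{2}(invmxK P) char_poly_conj ?unitmx_inv //.
  rewrite char_poly_trig ?diag_mx_is_trig // rmorph_prod /=.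
  apply: eq_bigr => i _; rewrite mxE eqxx mulr1n.
  by rewrite rmorphB /= map_polyX map_polyC /= dE.
- apply: rcI; rewrite -trace_map_mx -/C Ceq mxtrace_mulC mulmxA mulmxV // mul1mx.
  by rewrite mxtrace_diag rmorph_sum; apply: eq_bigr => i _; rewrite dE.
- apply: rcI; rewrite -trace_map_mx map_mxM -/C Ceq.
  have -> : invmx P *m diag_mx D *m P *m (invmx P *m diag_mx D *m P)
    = invmx P *m (diag_mx D *m diag_mx D *m P).
    by rewrite !mulmxA (mulmxK uP).
  rewrite mxtrace_mulC -!mulmxA mulmxV // mulmx1 rmorph_sum /=.
  by apply: eq_bigr => i _; rewrite mul_diag_mx !mxE eqxx mulr1n rmorphXn /= dE.
Qed.

Lemma sum_symmetric (V : zmodType) (n : nat) (v : 'I_n -> 'I_n -> V) :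
  (forall i j, v i j = v j i) ->
  \sum_i \sum_j v i j
  = (\sum_(i < n) \sum_(j < n | (i < j)%N) v i j) *+ 2 + \sum_i v i i.
Proof.
move=> vsym.
transitivity (\sum_(i < n) (\sum_(j < n | (i < j)%N) v i j
   + (\sum_(j < n | (j < i)%N) v i j + v i i))).
  apply: eq_bigr => i _; rewrite (bigID (fun j : 'I_n => (i < j)%N)) /=.
  congr (_ + _); rewrite (bigD1 i) ?ltnn //= addrC; congr (_ + _).
  by apply: eq_bigl => j; rewrite -leqNgt ltn_neqAle andbC.
rewrite !big_split /= addrA mulr2n; congr (_ + _ + _).
rewrite (exchange_big_dep xpredT) //=.
by apply: eq_bigr => i _; apply: eq_bigr => j _; rewrite vsym.
Qed.

(** The matrix [H G^-1] is conjugate to the matrix of [H] in the orthonormal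
    basis [E], which is symmetric; unique factorisation identifies the chosen
    eigenvalues with those of the spectral theorem up to order. *)
Lemma sigma2E (R : realType) (n : nat) (G H E : 'M[R]_n) :
  H^T = H -> E *m G *m E^T = 1%:M ->
  2 * sigma2 G H = (\tr (E *m H *m E^T)) ^+ 2
                   - \tr (E *m H *m E^T *m (E *m H *m E^T)).
Proof.
move=> Hsym EG; set S := E *m H *m E^T.
have Ssym : S^T = S by rewrite /S !trmx_mul trmxK Hsym mulmxA.
have [d [dchar dtr dtr2]] := symmetric_char_poly_splits Ssym.
have [uG _] := invmx_orthonormal EG.
have [uE _] := mulmx1_unit (etrans (mulmxA _ _ _) EG).
have charS : char_poly (H *m invmx G) = char_poly S.
  have invE : invmx E = G *m E^T.
    by rewrite -[invmx E]mulmx1 -EG -(mulmxA E) mulKmx.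
  have -> : S = E *m (H *m invmx G) *m invmx E.
    by rewrite invE /S -!mulmxA mulKmx.
  by rewrite char_poly_conj.
set s := eigenvalues (H *m invmx G).
have sE : char_poly S = \prod_(a <- s) ('X - a%:P).
  rewrite -charS; apply: (@xgetPex _ _ [set t : n.-tuple R |
    char_poly (H *m invmx G) = \prod_(a <- t) ('X - a%:P)]).
  exists [tuple d i | i < n] => /=.
  by rewrite charS dchar big_map big_enum.
have sd : perm_eq s [seq d i | i <- enum 'I_n].
  by apply: prod_XsubC_eq; rewrite -sE dchar big_map big_enum.
have sums (u : R -> R) : \sum_i u (tnth s i) = \sum_i u (d i).
  by rewrite -(big_tuple _ _ s xpredT u) (perm_big _ sd) /= big_map big_enum.
rewrite /sigma2 -/s dtr dtr2 -(sums id) -(sums (fun x => x ^+ 2)) /=.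
rewrite expr2 mulr_suml; under [\sum_i _ i * _]eq_bigr do rewrite mulr_sumr.
rewrite sum_symmetric; last by move=> i j; rewrite mulrC.
by rewrite addrK mulr_natl.
Qed.

(** * The quadratic form h4 on algebraic curvature tensors *)

Section Curvature_algebra.
Variables (R : realType) (n : nat).
Implicit Types (r T : 'I_n -> 'I_n -> 'I_n -> 'I_n -> R) (s E : 'M[R]_n).

Definition ricci_contraction r (j l : 'I_n) : R := \sum_a r a j a l.

(** Summing over all indices counts each pair of index pairs four times; hence
    the first division by 4. *)
Definition gauss_bonnet4 r : R :=
  (\sum_i \sum_j \sum_k \sum_l r i j k l ^+ 2) / 4
  - \sum_j \sum_l ricci_contraction r j l ^+ 2
  + (\sum_j ricci_contraction r j j) ^+ 2 / 4.

Definition antisym_pairs r : Prop :=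
  (forall i j k l, r i j k l = - r j i k l) /\
  (forall i j k l, r i j k l = - r i j l k).

Definition kulkarni_nomizu (g s : 'M[R]_n) (i j k l : 'I_n) : R :=
  g i k * s j l + g j l * s i k - g i l * s j k - g j k * s i l.

Lemma gauss_bonnet4_scale k r :
  gauss_bonnet4 (fun a b c d => k * r a b c d) = k ^+ 2 * gauss_bonnet4 r.
Proof.
have ricZ j l : ricci_contraction (fun a b c d => k * r a b c d) j l
    = k * ricci_contraction r j l by rewrite /ricci_contraction mulr_sumr.
have -> : gauss_bonnet4 (fun a b c d => k * r a b c d)
  = (k ^+ 2 * \sum_i \sum_j \sum_k \sum_l r i j k l ^+ 2) / 4
    - k ^+ 2 * \sum_j \sum_l ricci_contraction r j l ^+ 2
    + (k * \sum_j ricci_contraction r j j) ^+ 2 / 4.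
  rewrite /gauss_bonnet4; congr (_ / _ - _ + _ ^+ 2 / _).
  - by do 4!(rewrite mulr_sumr; apply: eq_bigr => ? _); rewrite exprMn.
  - by do 2!(rewrite mulr_sumr; apply: eq_bigr => ? _); rewrite ricZ exprMn.
  - by rewrite mulr_sumr; apply: eq_bigr => ? _; rewrite ricZ.
by rewrite /gauss_bonnet4; field.
Qed.

Lemma sum_sqr_ordered_pairs r : antisym_pairs r ->
  \sum_(i < n) \sum_(j < n | (i < j)%N) \sum_(k < n) \sum_(l < n | (k < l)%N)
    r i j k l ^+ 2 = (\sum_i \sum_j \sum_k \sum_l r i j k l ^+ 2) / 4.
Proof.
move=> [r12 r34].
have half (v : 'I_n -> 'I_n -> R) : (forall i j, v i j = v j i) ->
    (forall i, v i i = 0) ->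
    \sum_(i < n) \sum_(j < n | (i < j)%N) v i j = (\sum_i \sum_j v i j) / 2.
  move=> vsym v0; rewrite (sum_symmetric vsym) [X in _ + X]big1 // addr0.
  by rewrite -[X in X / _]mulr_natr mulfK // pnatr_eq0.
have r0 i k l : r i i k l = 0.
  by have := r12 i i k l; move/eqP; rewrite -subr_eq0 opprK -mulr2n mulrn_eq0 => /eqP.
have r0' i j k : r i j k k = 0.
  by have := r34 i j k k; move/eqP; rewrite -subr_eq0 opprK -mulr2n mulrn_eq0 => /eqP.
rewrite half; first last.
- by move=> i; apply: big1 => k _; apply: big1 => l _; rewrite r0 expr0n.
- by move=> i j; do 2!apply: eq_bigr => ? _; rewrite r12 sqrrN.
have -> : (4 : R) = 2 * 2 by rewrite -natrM.
rewrite invfM mulrA; congr (_ / _); rewrite mulr_suml; apply: eq_bigr => i _.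
rewrite mulr_suml; apply: eq_bigr => j _; rewrite half //.
- by move=> k l; rewrite r34 sqrrN.
- by move=> k; rewrite r0' expr0n.
Qed.

Lemma sum_delta (k : 'I_n) (F : 'I_n -> R) : \sum_i (i == k)%:R * F i = F k.
Proof.
rewrite (bigD1 k) //= eqxx mul1r big1 ?addr0 // => i /negPf ->.
by rewrite mul0r.
Qed.

Lemma kulkarni_nomizu_antisym g s : g^T = g -> s^T = s ->
  antisym_pairs (kulkarni_nomizu g s).
Proof. by move=> gT sT; split=> i j k l; rewrite /kulkarni_nomizu; ring. Qed.

(** The four terms of the Kulkarni-Nomizu product contribute equally: the
    antisymmetries of [r] carry each of them to the contraction of the first and
    third indices. *)
Lemma kulkarni_nomizu_pairing r s : antisym_pairs r ->
  \sum_i \sum_j \sum_k \sum_l r i j k l * kulkarni_nomizu 1%:M s i j k l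
  = 4 * \sum_j \sum_l ricci_contraction r j l * s j l.
Proof.
move=> [r12 r34].
have E1 : \sum_i \sum_j \sum_k \sum_l r i j k l * ((k == i)%:R * s j l)
    = \sum_j \sum_l ricci_contraction r j l * s j l.
  rewrite exchange_big; apply: eq_bigr => j _ /=.
  transitivity (\sum_i \sum_l r i j i l * s j l).
    apply: eq_bigr => i _; rewrite exchange_big; apply: eq_bigr => l _ /=.
    by under eq_bigr do rewrite mulrCA; rewrite sum_delta.
  by rewrite exchange_big; apply: eq_bigr => l _; rewrite mulr_suml.
have -> : \sum_i \sum_j \sum_k \sum_l r i j k l * kulkarni_nomizu 1%:M s i j k l
  = \sum_i \sum_j \sum_k \sum_l r i j k l * ((k == i)%:R * s j l)
  + \sum_i \sum_j \sum_k \sum_l r i j k l * ((l == j)%:R * s i k)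
  - \sum_i \sum_j \sum_k \sum_l r i j k l * ((l == i)%:R * s j k)
  - \sum_i \sum_j \sum_k \sum_l r i j k l * ((k == j)%:R * s i l).
  rewrite -big_split -!sumrB /=; apply: eq_bigr => i _.
  rewrite -big_split -!sumrB /=; apply: eq_bigr => j _.
  rewrite -big_split -!sumrB /=; apply: eq_bigr => k _.
  rewrite -big_split -!sumrB /=; apply: eq_bigr => l _.
  rewrite /kulkarni_nomizu !mxE ![k == _]eq_sym ![l == _]eq_sym; ring.
have -> : \sum_i \sum_j \sum_k \sum_l r i j k l * ((l == j)%:R * s i k)
   = \sum_i \sum_j \sum_k \sum_l r i j k l * ((k == i)%:R * s j l).
  rewrite exchange_big; apply: eq_bigr => i _; apply: eq_bigr => j _ /=.
  rewrite exchange_big; apply: eq_bigr => k _; apply: eq_bigr => l _ /=.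
  by rewrite r12 r34 opprK.
have -> : \sum_i \sum_j \sum_k \sum_l r i j k l * ((l == i)%:R * s j k)
   = - \sum_i \sum_j \sum_k \sum_l r i j k l * ((k == i)%:R * s j l).
  rewrite -sumrN; apply: eq_bigr => i _; rewrite -sumrN; apply: eq_bigr => j _.
  rewrite exchange_big -sumrN; apply: eq_bigr => k _.
  by rewrite -sumrN; apply: eq_bigr => l _ /=; rewrite r34 mulNr.
have -> : \sum_i \sum_j \sum_k \sum_l r i j k l * ((k == j)%:R * s i l)
   = - \sum_i \sum_j \sum_k \sum_l r i j k l * ((k == i)%:R * s j l).
  rewrite exchange_big -sumrN; apply: eq_bigr => i _ /=.
  rewrite -sumrN; apply: eq_bigr => j _.
  rewrite -sumrN; apply: eq_bigr => k _.
  by rewrite -sumrN; apply: eq_bigr => l _ /=; rewrite r12 mulNr.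
by rewrite E1; ring.
Qed.

Lemma ricci_kulkarni_nomizu s (j l : 'I_n) :
  ricci_contraction (kulkarni_nomizu 1%:M s) j l
  = (n%:R - 2) * s j l + \tr s * (j == l)%:R.
Proof.
rewrite /ricci_contraction /kulkarni_nomizu !sumrB big_split /=.
have -> : \sum_(i < n) (1%:M : 'M[R]_n) i i * s j l = n%:R * s j l.
  under eq_bigr do rewrite mxE eqxx mul1r.
  by rewrite sumr_const card_ord mulr_natl.
have -> : \sum_(i < n) (1%:M : 'M[R]_n) j l * s i i = \tr s * (j == l)%:R.
  by rewrite -mulr_sumr mxE mulrC.
have -> : \sum_(i < n) (1%:M : 'M[R]_n) i l * s j i = s j l.
  under eq_bigr do rewrite mxE.
  by rewrite sum_delta.
have -> : \sum_(i < n) (1%:M : 'M[R]_n) j i * s i l = s j l.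
  under eq_bigr do rewrite mxE eq_sym.
  by rewrite sum_delta.
by ring.
Qed.

(** The expansion of a square.  The pairing lemma is used for the cross term
    and, with the Kulkarni-Nomizu product itself in the role of [r], for its
    norm; all coefficients then come from [ricci_kulkarni_nomizu]. *)
Lemma gauss_bonnet4_sub_kulkarni_nomizu r s : antisym_pairs r -> s^T = s ->
  let N : R := n%:R in
  gauss_bonnet4 (fun i j k l => r i j k l - kulkarni_nomizu 1%:M s i j k l)
  = gauss_bonnet4 r
    - 2 * (N - 3) * ((\sum_j ricci_contraction r j j) / 2 * \tr s
                     - \sum_j \sum_l ricci_contraction r j l * s j l)
    + (N - 2) * (N - 3) * ((\tr s) ^+ 2 - \sum_j \sum_l s j l ^+ 2).
Proof.
move=> rA sT N.
have kA := kulkarni_nomizu_antisym (trmx1 _ _) sT.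
have ricB j l : ricci_contraction
    (fun i j k l => r i j k l - kulkarni_nomizu 1%:M s i j k l) j l
    = ricci_contraction r j l - ((N - 2) * s j l + \tr s * (j == l)%:R).
  by rewrite -ricci_kulkarni_nomizu /ricci_contraction sumrB.
have scal_eq : \sum_j ((N - 2) * s j j + \tr s * (j == j)%:R) = 2 * (N - 1) * \tr s.
  under eq_bigr do rewrite eqxx mulr1.
  by rewrite big_split /= -mulr_sumr sumr_const card_ord -mulr_natl -/(\tr s) -/N; ring.
have pair_eq (v : 'I_n -> 'I_n -> R) :
    \sum_j \sum_l v j l * ((N - 2) * s j l + \tr s * (j == l)%:R)
    = (N - 2) * (\sum_j \sum_l v j l * s j l) + \tr s * \sum_j v j j.
  rewrite !mulr_sumr -big_split; apply: eq_bigr => j _ /=.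
  transitivity (\sum_l ((N - 2) * (v j l * s j l) + (l == j)%:R * (\tr s * v j l))).
    by apply: eq_bigr => l _; rewrite (eq_sym l); ring.
  by rewrite big_split /= sum_delta mulr_sumr.
rewrite /gauss_bonnet4.
have -> : \sum_i \sum_j \sum_k \sum_l
    (r i j k l - kulkarni_nomizu 1%:M s i j k l) ^+ 2
  = \sum_i \sum_j \sum_k \sum_l r i j k l ^+ 2
    - 2 * \sum_i \sum_j \sum_k \sum_l r i j k l * kulkarni_nomizu 1%:M s i j k l
    + \sum_i \sum_j \sum_k \sum_l
        kulkarni_nomizu 1%:M s i j k l * kulkarni_nomizu 1%:M s i j k l.
  rewrite mulr_sumr -sumrB -big_split; apply: eq_bigr => i _ /=.
  rewrite mulr_sumr -sumrB -big_split; apply: eq_bigr => j _ /=.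
  rewrite mulr_sumr -sumrB -big_split; apply: eq_bigr => k _ /=.
  rewrite mulr_sumr -sumrB -big_split; apply: eq_bigr => l _ /=.
  by ring.
rewrite (kulkarni_nomizu_pairing _ rA) (kulkarni_nomizu_pairing _ kA).
under [\sum_j ricci_contraction (fun _ => _) j j]eq_bigr do rewrite ricB.
rewrite sumrB scal_eq.
have -> : \sum_j \sum_l ricci_contraction
    (fun i j k l => r i j k l - kulkarni_nomizu 1%:M s i j k l) j l ^+ 2
  = \sum_j \sum_l ricci_contraction r j l ^+ 2
    - 2 * \sum_j \sum_l ricci_contraction r j l
          * ((N - 2) * s j l + \tr s * (j == l)%:R)
    + \sum_j \sum_l ((N - 2) * s j l + \tr s * (j == l)%:R)
          * ((N - 2) * s j l + \tr s * (j == l)%:R).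
  rewrite mulr_sumr -sumrB -big_split; apply: eq_bigr => j _ /=.
  rewrite mulr_sumr -sumrB -big_split; apply: eq_bigr => l _ /=.
  by rewrite ricB; ring.
rewrite !pair_eq scal_eq.
have kn_s : \sum_j \sum_l ricci_contraction (kulkarni_nomizu 1%:M s) j l * s j l
   = (N - 2) * \sum_j \sum_l s j l ^+ 2 + (\tr s) ^+ 2.
  transitivity (\sum_j \sum_l s j l * ((N - 2) * s j l + \tr s * (j == l)%:R)).
    by do 2!apply: eq_bigr => ? _; rewrite ricci_kulkarni_nomizu mulrC.
  by rewrite pair_eq.
have s_kn : \sum_j \sum_l ((N - 2) * s j l + \tr s * (j == l)%:R) * s j l
   = (N - 2) * \sum_j \sum_l s j l ^+ 2 + (\tr s) ^+ 2.
  rewrite -kn_s.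
  by do 2!apply: eq_bigr => ? _; rewrite ricci_kulkarni_nomizu.
rewrite kn_s s_kn.
set SR := \sum_i \sum_j \sum_k \sum_l _; set SC := \sum_j ricci_contraction r j j.
by field.
Qed.

End Curvature_algebra.

(** * Components in a frame and independence of the frame *)

Section Frames.
Variables (R : realType) (n : nat).
Implicit Types (T : 'I_n -> 'I_n -> 'I_n -> 'I_n -> R) (E G B K : 'M[R]_n)
  (u v w z : 'rV[R]_n).

Definition tensor_eval T u v w z : R :=
  \sum_i \sum_j \sum_k \sum_l u 0 i * v 0 j * w 0 k * z 0 l * T i j k l.

Definition frame_components T E (a b c d : 'I_n) : R :=
  tensor_eval T (row a E) (row b E) (row c E) (row d E).

Definition ricci_mx T K : 'M[R]_n :=
  \matrix_(j, l) \sum_i \sum_k K i k * T i j k l.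

Lemma form_ofE B v w : form_of B v w = \sum_i \sum_j v 0 i * w 0 j * B i j.
Proof.
rewrite /form_of mxE exchange_big; apply: eq_bigr => j _ /=.
rewrite !mxE mulr_suml; apply: eq_bigr => i _; ring.
Qed.

Lemma form_of_rows B E (a b : 'I_n) :
  form_of B (row a E) (row b E) = (E *m B *m E^T) a b.
Proof. by rewrite /form_of tr_row -row_mul !mxE; apply: eq_bigr => k _; rewrite !mxE. Qed.

Lemma tensor_evalZ k T u v w z :
  tensor_eval (fun i j k' l => k * T i j k' l) u v w z = k * tensor_eval T u v w z.
Proof.
rewrite /tensor_eval; do 4!(rewrite mulr_sumr; apply: eq_bigr => ? _); ring.
Qed.

Lemma tensor_evalB T T' u v w z :
  tensor_eval (fun i j k l => T i j k l - T' i j k l) u v w z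
  = tensor_eval T u v w z - tensor_eval T' u v w z.
Proof.
rewrite /tensor_eval; do 4!(rewrite -sumrB; apply: eq_bigr => ? _); ring.
Qed.

Lemma tensor_evalD T T' u v w z :
  tensor_eval (fun i j k l => T i j k l + T' i j k l) u v w z
  = tensor_eval T u v w z + tensor_eval T' u v w z.
Proof.
rewrite /tensor_eval; do 4!(rewrite -big_split; apply: eq_bigr => ? _ /=); ring.
Qed.

Lemma tensor_eval_swap12 T u v w z :
  tensor_eval (fun i j k l => T j i k l) u v w z = tensor_eval T v u w z.
Proof.
rewrite /tensor_eval exchange_big; do 4!(apply: eq_bigr => ? _ /=); ring.
Qed.

Lemma tensor_eval_swap34 T u v w z :
  tensor_eval (fun i j k l => T i j l k) u v w z = tensor_eval T u v z w.
Proof.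
rewrite /tensor_eval; apply: eq_bigr => i _; apply: eq_bigr => j _.
rewrite exchange_big; do 2!(apply: eq_bigr => ? _ /=); ring.
Qed.

Lemma tensor_eval_prod G B u v w z :
  tensor_eval (fun i j k l => G i k * B j l) u v w z
  = form_of G u w * form_of B v z.
Proof.
rewrite !form_ofE mulr_suml; apply: eq_bigr => i _; rewrite exchange_big /=.
rewrite mulr_suml; apply: eq_bigr => k _; rewrite mulr_sumr.
apply: eq_bigr => j _; rewrite mulr_sumr; apply: eq_bigr => l _; ring.
Qed.

Lemma eq_tensor_eval T T' u v w z : (forall i j k l, T i j k l = T' i j k l) ->
  tensor_eval T u v w z = tensor_eval T' u v w z.
Proof. by move=> TT'; do 4!(apply: eq_bigr => ? _ /=); rewrite TT'. Qed.

Lemma frame_kulkarni_nomizu G B E (a b c d : 'I_n) :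
  frame_components (kulkarni_nomizu G B) E a b c d
  = kulkarni_nomizu (E *m G *m E^T) (E *m B *m E^T) a b c d.
Proof.
rewrite /frame_components /kulkarni_nomizu -!form_of_rows.
rewrite !tensor_evalB tensor_evalD tensor_eval_prod.
rewrite (tensor_eval_swap34 (fun i j k l => G i k * B j l)) tensor_eval_prod.
have sw : forall i j k l, G j l * B i k = B i k * G j l by move=> *; rewrite mulrC.
rewrite (eq_tensor_eval _ _ _ _ sw) tensor_eval_prod.
have sw' : forall i j k l, G j k * B i l = B i l * G j k by move=> *; rewrite mulrC.
rewrite (eq_tensor_eval _ _ _ _ sw').
rewrite (tensor_eval_swap34 (fun i j k l => B i k * G j l)) tensor_eval_prod.
by ring.
Qed.

Lemma frame_antisym T E : antisym_pairs T -> antisym_pairs (frame_components T E).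
Proof.
move=> [T12 T34]; split=> a b c d; rewrite /frame_components.
- rewrite -tensor_eval_swap12 -[RHS]mulN1r -tensor_evalZ; apply: eq_tensor_eval.
  by move=> i j k l; rewrite mulN1r -T12.
- rewrite -[in RHS]tensor_eval_swap34 -[RHS]mulN1r -tensor_evalZ.
  by apply: eq_tensor_eval => i j k l; rewrite mulN1r -T34.
Qed.

Lemma frame_componentsZ T E k (a b c d : 'I_n) :
  frame_components T (k *: E) a b c d = k ^+ 4 * frame_components T E a b c d.
Proof.
rewrite /frame_components /tensor_eval.
do 4!(rewrite mulr_sumr; apply: eq_bigr => ? _); rewrite !mxE; ring.
Qed.

(** The sum over an orthonormal frame is a contraction with the inverse metric
    [E^T E], so the Ricci form is bilinear with a matrix that only depends on
    [E^T E]. *)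
Lemma ricci_eval T E v w :
  \sum_a tensor_eval T (row a E) v (row a E) w = form_of (ricci_mx T (E^T *m E)) v w.
Proof.
rewrite form_ofE.
transitivity (\sum_a \sum_j \sum_l \sum_i \sum_k
    v 0 j * w 0 l * (E a i * E a k * T i j k l)).
  apply: eq_bigr => a _; rewrite /tensor_eval exchange_big; apply: eq_bigr => j _ /=.
  under eq_bigr do rewrite exchange_big.
  rewrite /= exchange_big; do 3!(apply: eq_bigr => ? _ /=); rewrite !mxE; ring.
rewrite exchange_big; apply: eq_bigr => j _ /=.
rewrite exchange_big; apply: eq_bigr => l _ /=.
rewrite mxE mulr_sumr exchange_big; apply: eq_bigr => i _ /=.
rewrite mulr_sumr exchange_big; apply: eq_bigr => k _ /=.
rewrite mxE mulr_suml mulr_sumr; apply: eq_bigr => a _; rewrite mxE; ring.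
Qed.

Lemma ricci_frame T E (j l : 'I_n) :
  ricci_contraction (frame_components T E) j l
  = (E *m ricci_mx T (E^T *m E) *m E^T) j l.
Proof. by rewrite /ricci_contraction ricci_eval form_of_rows. Qed.

(** The squared length of the vector [M t] only depends on the Gram matrix of the
    columns of [M]. *)
Lemma sum_sqr_gram_eq (I J : finType) (M M' : J -> I -> R) (t : I -> R) :
  (forall i i', \sum_a M a i * M a i' = \sum_a M' a i * M' a i') ->
  \sum_a (\sum_i M a i * t i) ^+ 2 = \sum_a (\sum_i M' a i * t i) ^+ 2.
Proof.
have expand (P : J -> I -> R) : \sum_a (\sum_i P a i * t i) ^+ 2
    = \sum_i \sum_i' t i * t i' * \sum_a P a i * P a i'.
  transitivity (\sum_a \sum_i \sum_i' t i * t i' * (P a i * P a i')).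
    apply: eq_bigr => a _; rewrite expr2 big_distrlr /=.
    by do 2!(apply: eq_bigr => ? _); ring.
  rewrite exchange_big; apply: eq_bigr => i _ /=.
  by rewrite exchange_big; apply: eq_bigr => i' _ /=; rewrite mulr_sumr.
move=> MM'; rewrite !expand; do 2!(apply: eq_bigr => ? _).
by rewrite MM'.
Qed.

(** Iterated, this handles all four slots of a curvature tensor at once: its
    components in a frame are the image of its coordinates by the fourth tensor
    power of the frame matrix. *)
Lemma gram_tensor (I J I' J' : finType) (M1 M1' : J -> I -> R) (M2 M2' : J' -> I' -> R) :
  (forall i i', \sum_a M1 a i * M1 a i' = \sum_a M1' a i * M1' a i') ->
  (forall i i', \sum_a M2 a i * M2 a i' = \sum_a M2' a i * M2' a i') ->
  forall i i', \sum_a (M1 a.1 i.1 * M2 a.2 i.2) * (M1 a.1 i'.1 * M2 a.2 i'.2)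
             = \sum_a (M1' a.1 i.1 * M2' a.2 i.2) * (M1' a.1 i'.1 * M2' a.2 i'.2).
Proof.
have split_gram (P1 : J -> I -> R) (P2 : J' -> I' -> R) i i' :
    \sum_a (P1 a.1 i.1 * P2 a.2 i.2) * (P1 a.1 i'.1 * P2 a.2 i'.2)
    = (\sum_a P1 a i.1 * P1 a i'.1) * (\sum_a P2 a i.2 * P2 a i'.2).
  rewrite big_distrlr pair_bigA /=; apply: eq_bigr => a _; ring.
by move=> e1 e2 i i'; rewrite !split_gram e1 e2.
Qed.

(** For frames that are orthonormal for a metric [G] the condition says that
    [G] is the same: both sides are then [G^-1], see [invmx_orthonormal]. *)
Lemma gauss_bonnet4_frame_indep T E E' : E^T *m E = E'^T *m E' ->
  gauss_bonnet4 (frame_components T E) = gauss_bonnet4 (frame_components T E').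
Proof.
move=> EE'; rewrite /gauss_bonnet4; congr (_ / _ - _ + _ ^+ 2 / _).
- have gE i i' : \sum_a E a i * E a i' = \sum_a E' a i * E' a i'.
    have := congr1 (fun K : 'M[R]_n => K i i') EE'; rewrite !mxE.
    by under eq_bigr do rewrite mxE; under [in RHS]eq_bigr do rewrite mxE.
  pose M (F : 'M[R]_n) (a b : 'I_n) := F a b.
  have flat F : \sum_a \sum_b \sum_c \sum_d frame_components T F a b c d ^+ 2
    = \sum_(x : 'I_n * 'I_n * 'I_n * 'I_n)
        (\sum_(y : 'I_n * 'I_n * 'I_n * 'I_n)
           M F x.1.1.1 y.1.1.1 * M F x.1.1.2 y.1.1.2 * M F x.1.2 y.1.2 * M F x.2 y.2
           * T y.1.1.1 y.1.1.2 y.1.2 y.2) ^+ 2.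
    rewrite !pair_bigA; apply: eq_bigr => -[[[a b] c] d] _ /=; congr (_ ^+ 2).
    rewrite /frame_components /tensor_eval !pair_bigA.
    by apply: eq_bigr => -[[[i j] k] l] _ /=; rewrite !mxE.
  rewrite !flat; apply: sum_sqr_gram_eq.
  exact: (gram_tensor (gram_tensor (gram_tensor gE gE) gE) gE).
- have tr2 F : \sum_j \sum_l ricci_contraction (frame_components T F) j l ^+ 2
    = \tr (ricci_mx T (F^T *m F) *m (F^T *m F)
           *m ((ricci_mx T (F^T *m F))^T *m (F^T *m F))).
    set B := ricci_mx _ _.
    transitivity (\tr ((F *m B *m F^T) *m (F *m B *m F^T)^T)).
      rewrite /mxtrace; apply: eq_bigr => j _; rewrite mxE; apply: eq_bigr => l _.
      by rewrite ricci_frame [(_^T) l j]mxE expr2.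
    by rewrite !trmx_mul trmxK -!mulmxA mxtrace_mulC -!mulmxA.
  by rewrite !tr2 EE'.
- have tr1 F : \sum_j ricci_contraction (frame_components T F) j j
    = \tr (ricci_mx T (F^T *m F) *m (F^T *m F)).
    rewrite mulmxA mxtrace_mulC mulmxA.
    by rewrite /mxtrace; apply: eq_bigr => j _; rewrite ricci_frame.
  by rewrite !tr1 EE'.
Qed.

End Frames.

(** * Substitution of the tensor A *)

Section Schouten_algebra.
Variables (R : realType) (n : nat).
Implicit Types (r : 'I_n -> 'I_n -> 'I_n -> 'I_n -> R) (S : 'M[R]_n) (u : 'rV[R]_n).

(** Here [S], [u] are the components of the Hessian and of the differential in
    an orthonormal frame, and [s] those of the tensor [A].  The lemma is
    bookkeeping: the pairings of [s] with the Ricci tensor and with itself are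
    expanded through [pairE]. *)
Lemma gauss_bonnet4_schouten r S u : antisym_pairs r -> S^T = S ->
  let N : R := n%:R in
  let q := \sum_a u 0 a ^+ 2 in
  let sc := \sum_j ricci_contraction r j j in
  gauss_bonnet4 (fun i j k l => r i j k l
    - kulkarni_nomizu 1%:M (S - u^T *m u + (q / 2)%:M) i j k l)
  = gauss_bonnet4 r
    + (N - 2) * (N - 3) * ((\tr S) ^+ 2 - \tr (S *m S))
    - 2 * (N - 3) * (sc / 2 * \tr S - \sum_j \sum_l ricci_contraction r j l * S j l)
    + (N - 2) * (N - 3) ^+ 2 * \tr S * q
    + 2 * (N - 2) * (N - 3) * form_of S u u
    + 2 * (N - 3) * (sc / 2 * q
        - \sum_j \sum_l u 0 j * u 0 l * ricci_contraction r j l)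
    - (N - 2) * (N - 3) * (sc / 2) * q
    + (N - 1) * (N - 2) * (N - 3) * (N - 4) / 4 * q ^+ 2.
Proof.
move=> rA Ssym N q sc; set s := S - _ + _.
have ssym : s^T = s.
  by rewrite /s linearD linearB /= trmx_mul trmxK Ssym tr_scalar_mx.
have sE j l : s j l = S j l - u 0 j * u 0 l + q / 2 * (j == l)%:R.
  by rewrite !mxE big_ord1 !mxE mulr_natr.
rewrite (gauss_bonnet4_sub_kulkarni_nomizu rA ssym) -/N -/sc.
have pairE (v : 'I_n -> 'I_n -> R) : \sum_j \sum_l v j l * s j l
    = \sum_j \sum_l v j l * S j l - \sum_j \sum_l u 0 j * u 0 l * v j l
      + q / 2 * \sum_j v j j.
  rewrite mulr_sumr -sumrB -big_split; apply: eq_bigr => j _ /=.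
  transitivity (\sum_l (v j l * S j l - u 0 j * u 0 l * v j l
      + (l == j)%:R * (q / 2 * v j l))).
    by apply: eq_bigr => l _; rewrite sE (eq_sym l); ring.
  by rewrite big_split sumrB /= sum_delta.
have trs : \tr s = \tr S - q + N * (q / 2).
  rewrite /s linearD linearB /= mxtrace_scalar -[X in _ + X]mulr_natl -/N.
  congr (_ - _ + _); rewrite mxtrace_mulC trace_mx11 mxE.
  by apply: eq_bigr => a _; rewrite mxE.
have SS : \tr (S *m S) = \sum_j \sum_l S j l * S j l.
  by apply: eq_bigr => j _; rewrite mxE; apply: eq_bigr => l _; rewrite -{2}Ssym mxE.
have uuS : \sum_j \sum_l u 0 j * u 0 l * S j l = form_of S u u by rewrite form_ofE.
have q2 : \sum_j \sum_l u 0 j * u 0 l * (u 0 j * u 0 l) = q ^+ 2.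
  by rewrite expr2 /q big_distrlr; do 2!(apply: eq_bigr => ? _ /=); ring.
have ss : \sum_j \sum_l s j l ^+ 2
    = \tr (S *m S) - form_of S u u + q / 2 * \tr S
      - (form_of S u u - q ^+ 2 + q / 2 * q) + q / 2 * \tr s.
  have -> : \sum_j \sum_l s j l ^+ 2 = \sum_j \sum_l s j l * s j l by [].
  rewrite pairE; congr (_ - _ + _).
    transitivity (\sum_j \sum_l S j l * s j l).
      by do 2!(apply: eq_bigr => ? _); rewrite mulrC.
    by rewrite pairE uuS SS.
  by rewrite pairE uuS q2.
rewrite ss trs pairE -/sc; clear pairE trs ss SS uuS q2 sE ssym s.
move: (gauss_bonnet4 r) (\tr S) (\tr (S *m S)) (form_of S u u) (\sum_j \sum_l _)
 (\sum_j \sum_l _) q sc => b t t2 al x1 x2 q' sc'.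
by field.
Qed.

End Schouten_algebra.

(** * Symmetry of second derivatives *)

Section Mixed_derivatives.
Variables (R : realType) (V : normedModType R).
Implicit Types (F : V -> R) (x y v w : V).

Lemma is_derive_line F y v (s : R) : derivable F (y + s *: v) v ->
  is_derive s 1 (fun t : R => F (y + t *: v)) ('D_v F (y + s *: v)).
Proof.
move=> dF.
have eqq : (fun h : R => h^-1 *: (((fun t : R => F (y + t *: v)) \o shift s) (h *: 1)
     - F (y + s *: v)))
  = (fun h : R => h^-1 *: ((F \o shift (y + s *: v)) (h *: v) - F (y + s *: v))).
  apply/funext => h /=; congr (_ *: (F _ - _)).
  by rewrite [h *: 1]mulr1 scalerDl addrCA.
by split; rewrite /derivable /derive /= eqq.
Qed.

Lemma is_derive_expR_comp F x v (a : R) : is_derive x v F a ->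
  is_derive x v (fun y => expR (F y)) (expR (F x) * a).
Proof.
move=> [dF Da].
have x0 : x + 0 *: v = x by rewrite scale0r addr0.
have [|dF0 D0] := @is_derive_line F x v 0; first by rewrite x0.
have lineE (H : V -> R) : (fun h : R => h^-1 *: ((H \o shift x) (h *: v) - H x))
   = (fun h : R => h^-1 *: (((fun t : R => H (x + t *: v)) \o shift 0) (h *: 1)
     - H (x + 0 *: v))).
  apply/funext => h /=; rewrite x0; congr (_ *: (H _ - _)).
  by rewrite [h *: 1]mulr1 addr0 addrC.
have dE : is_derive (0 : R) 1 (expR \o (fun t : R => F (x + t *: v))) (expR (F x) * a).
  have := @is_derive1_comp _ _ _ _ _ _ (is_derive_expR _) (DeriveDef dF0 D0).
  by rewrite /= x0 Da.
case: dE => dE1 dE2; split; first by rewrite /derivable lineE.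
by rewrite -dE2 /derive lineE.
Qed.

(** Two applications of the mean value theorem to the second difference. *)
Lemma mean_value_second F x v w (h : R) : 0 <= h ->
  (forall s t, 0 <= s <= h -> 0 <= t <= h ->
     derivable F (x + s *: v + t *: w) v /\
     derivable ('D_v F) (x + s *: v + t *: w) w) ->
  exists s t, [/\ 0 <= s <= h, 0 <= t <= h &
    F (x + h *: v + h *: w) - F (x + h *: v) - (F (x + h *: w) - F x)
    = 'D_w ('D_v F) (x + s *: v + t *: w) * h * h].
Proof.
move=> h0 dF.
have h00 : 0 <= (0 : R) <= h by rewrite lexx.
have hhh : 0 <= h <= h by rewrite h0 lexx.
pose phi (s : R) := F (x + h *: w + s *: v) - F (x + 0 *: w + s *: v).
have dphi (s : R) : s \in `[0, h]%R -> is_derive s 1 phi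
    ('D_v F (x + h *: w + s *: v) - 'D_v F (x + 0 *: w + s *: v)).
  rewrite in_itv /= => sh; apply: is_deriveB; apply: is_derive_line.
  - by rewrite addrAC; exact: (dF _ _ sh hhh).1.
  - by rewrite addrAC; exact: (dF _ _ sh h00).1.
have cphi : {within `[0, h], continuous phi}.
  by apply: derivable_within_continuous => s /dphi [].
have dphi_oo (s : R) : s \in `]0, h[%R -> is_derive s 1 phi
    ('D_v F (x + h *: w + s *: v) - 'D_v F (x + 0 *: w + s *: v)).
  by move=> sh; apply: dphi; apply: subset_itv_oo_cc.
have [s] := MVT_segment h0 dphi_oo cphi.
rewrite in_itv /= => sh phiE.
pose psi (t : R) := 'D_v F (x + s *: v + t *: w).
have dpsi (t : R) : t \in `[0, h]%R -> is_derive t 1 psi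
    ('D_w ('D_v F) (x + s *: v + t *: w)).
  rewrite in_itv /= => th; apply: is_derive_line; exact: (dF _ _ sh th).2.
have cpsi : {within `[0, h], continuous psi}.
  by apply: derivable_within_continuous => t /dpsi [].
have dpsi_oo (t : R) : t \in `]0, h[%R -> is_derive t 1 psi
    ('D_w ('D_v F) (x + s *: v + t *: w)).
  by move=> th; apply: dpsi; apply: subset_itv_oo_cc.
have [t] := MVT_segment h0 dpsi_oo cpsi.
rewrite in_itv /= => th psiE.
exists s, t; split=> //; rewrite !subr0 in phiE psiE.
rewrite -psiE /psi (addrAC x (s *: v) (h *: w)) (addrAC x (s *: v) (0 *: w)) -phiE /phi.
by rewrite !scale0r !addr0 (addrAC x).
Qed.

Lemma near_box (P : set V) x v w : (\forall y \near x, P y) ->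
  exists2 h : R, 0 < h & forall s t, 0 <= s <= h -> 0 <= t <= h ->
    P (x + s *: v + t *: w).
Proof.
move=> /nbhs_normP[e /= e0 eP].
have c0 : 0 < `|v| + `|w| + 1 by rewrite ltr_wpDl ?addr_ge0.
exists (e / (`|v| + `|w| + 1)); first exact: divr_gt0.
move=> s t /andP[s0 sh] /andP[t0 th]; apply: eP => /=.
rewrite -addrA opprD addrA subrr add0r normrN.
apply: (le_lt_trans (ler_normD _ _)); rewrite !normrZ !ger0_norm //.
have -> : e = e / (`|v| + `|w| + 1) * `|v| + e / (`|v| + `|w| + 1) * `|w|
   + e / (`|v| + `|w| + 1) by field; rewrite gt_eqF.
by rewrite ltr_pwDr ?divr_gt0 // lerD // ler_wpM2r.
Qed.

(** The second difference is symmetric in [v] and [w], so the mean value theorem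
    gives points arbitrarily close to [x] where the two mixed derivatives agree;
    continuity concludes. *)
Theorem derive_commute F x v w :
  (\forall y \near x, [/\ derivable F y v, derivable F y w,
     derivable ('D_v F) y w & derivable ('D_w F) y v]) ->
  {for x, continuous ('D_w ('D_v F))} -> {for x, continuous ('D_v ('D_w F))} ->
  'D_w ('D_v F) x = 'D_v ('D_w F) x.
Proof.
move=> dF cvw cwv; apply/eqP; rewrite -subr_eq0 -normr_le0.
have close (r a b m : R) : `|a - m| < r / 2 -> `|b - m| < r / 2 -> `|a - b| <= r.
  move=> am bm; have ab := ler_distD m a b; rewrite (distrC m) in ab.
  by apply: le_trans ab _; rewrite [leRHS]splitr lerD // ltW.
apply/ler_addgt0Pr => e e0; rewrite add0r.
have e20 : 0 < e / 2 by rewrite divr_gt0.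
have nvw : \forall y \near x, `|'D_w ('D_v F) x - 'D_w ('D_v F) y| < e / 2.
  by move/cvgrPdist_lt: cvw; apply.
have nwv : \forall y \near x, `|'D_v ('D_w F) x - 'D_v ('D_w F) y| < e / 2.
  by move/cvgrPdist_lt: cwv; apply.
have [h h0 hP] := near_box v w (filterI dF (filterI nvw nwv)).
have [|s [t [sh th E1]]] := @mean_value_second F x v w h (ltW h0).
  by move=> s t sh th; have [[]] := hP _ _ sh th.
have [|s' [t' [sh' th' E2]]] := @mean_value_second F x w v h (ltW h0).
  by move=> s' t' sh' th'; rewrite addrAC; have [[]] := hP _ _ th' sh'.
have [_ [D1 _]] := hP _ _ sh th.
have [_ [_ D2]] := hP _ _ th' sh'.
rewrite (addrAC x (h *: w)) (addrAC x (s' *: w)) in E2.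
have D12 : 'D_w ('D_v F) (x + s *: v + t *: w) = 'D_v ('D_w F) (x + t' *: v + s' *: w).
  have hn0 : h != 0 by rewrite gt_eqF.
  apply: (mulIf hn0); apply: (mulIf hn0); apply: etrans (esym E1) _.
  by apply: etrans E2; ring.
by apply: close D1 _; rewrite D12.
Qed.

End Mixed_derivatives.

(** * Differentiation of metrics on an open set *)

Section Rules.
Variables (R : realType) (V : normedModType R).
Implicit Types (f g : V -> R) (x v : V).

Lemma is_derive_mul f g x v a b : is_derive x v f a -> is_derive x v g b ->
  is_derive x v (fun y => f y * g y) (f x * b + g x * a).
Proof. exact: is_deriveM. Qed.

Lemma is_derive_add f g x v a b : is_derive x v f a -> is_derive x v g b ->
  is_derive x v (fun y => f y + g y) (a + b).
Proof. exact: is_deriveD. Qed.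

Lemma is_derive_sub f g x v a b : is_derive x v f a -> is_derive x v g b ->
  is_derive x v (fun y => f y - g y) (a - b).
Proof. exact: is_deriveB. Qed.

Lemma is_derive_scal k f x v a : is_derive x v f a ->
  is_derive x v (fun y => k * f y) (k * a).
Proof. exact: is_deriveZ. Qed.

Lemma is_derive_bigsum (n : nat) (f : 'I_n -> V -> R) x v (a : 'I_n -> R) :
  (forall i, is_derive x v (f i) (a i)) ->
  is_derive x v (fun y => \sum_i f i y) (\sum_i a i).
Proof.
move=> fa; have -> : (fun y => \sum_i f i y) = \sum_i f i.
  by apply/funext => y; rewrite fct_sumE.
exact: is_derive_sum.
Qed.

Lemma derivable_mul f g x v : derivable f x v -> derivable g x v ->
  derivable (fun y => f y * g y) x v.
Proof. exact: derivableM. Qed.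

Lemma derivable_bigsum (I : Type) (s : seq I) (P : pred I) (f : I -> V -> R) x v :
  (forall i, derivable (f i) x v) -> derivable (fun y => \sum_(i <- s | P i) f i y) x v.
Proof.
move=> df; elim: s => [|i s IH].
  by under eq_fun do rewrite big_nil; exact: derivable_cst.
case Pi: (P i); last by under eq_fun do rewrite big_cons Pi.
under eq_fun do rewrite big_cons Pi.
exact: (derivableD (df i) IH).
Qed.

Lemma derivable_bigprod (I : Type) (s : seq I) (P : pred I) (f : I -> V -> R) x v :
  (forall i, derivable (f i) x v) -> derivable (fun y => \prod_(i <- s | P i) f i y) x v.
Proof.
move=> df; elim: s => [|i s IH].
  by under eq_fun do rewrite big_nil; exact: derivable_cst.
case Pi: (P i); last by under eq_fun do rewrite big_cons Pi.
under eq_fun do rewrite big_cons Pi.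
exact: (derivable_mul (df i) IH).
Qed.

Lemma derivable_det (n : nat) (A : V -> 'M[R]_n) x v :
  (forall i j, derivable (fun y => A y i j) x v) -> derivable (fun y => \det (A y)) x v.
Proof.
move=> dA; rewrite /determinant; apply: derivable_bigsum => s.
apply: derivable_mul; first exact: derivable_cst.
exact: derivable_bigprod.
Qed.

(** By Cramer's rule the inverse is a rational function of the entries. *)
Lemma derivable_invmx (n : nat) (A : V -> 'M[R]_n) x v (k l : 'I_n) :
  (\forall y \near x, A y \in unitmx) ->
  (forall i j, derivable (fun y => A y i j) x v) ->
  derivable (fun y => invmx (A y) k l) x v.
Proof.
move=> uA dA.
apply: (@near_eq_derivable _ _ _ (fun y => (\det (A y))^-1 * cofactor (A y) l k)).
  by apply: filterS uA => y uAy; rewrite /invmx uAy !mxE.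
apply: derivable_mul.
  apply: derivableV; last exact: derivable_det.
  by have := nbhs_singleton uA; rewrite unitmxE unitfE.
rewrite /cofactor; apply: derivable_mul; first exact: derivable_cst.
apply: derivable_det => i j; under eq_fun do rewrite !mxE.
exact: dA.
Qed.

End Rules.

Section Open_set.
Variables (R : realType) (n : nat) (U : set 'rV[R]_n).
Hypothesis oU : open U.
Implicit Types (F H : 'rV[R]_n -> R) (G : 'rV[R]_n -> 'M[R]_n) (y : 'rV[R]_n).

Lemma partial_eq_on F H y (i : 'I_n) : (forall z, U z -> F z = H z) -> U y ->
  partial i F y = partial i H y.
Proof.
move=> FH Uy; apply: near_eq_derive.
by apply: filterS (open_nbhs_nbhs (conj oU Uy)) => z; exact: FH.
Qed.

Lemma derivable_eq_on F H y v : (forall z, U z -> F z = H z) -> U y ->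
  derivable F y v -> derivable H y v.
Proof.
move=> FH Uy; apply: near_eq_derivable.
by apply: filterS (open_nbhs_nbhs (conj oU Uy)) => z; exact: FH.
Qed.

(** The part of the C^2 condition that the curvature computation uses.  Only
    directional derivatives occur, so that it passes to products and
    exponentials by the Leibniz and chain rules. *)
Definition twice_derivable_on F : Prop := forall y, U y ->
  [/\ forall i, derivable F y (delta_mx 0 i),
      forall i j, derivable (partial i F) y (delta_mx 0 j) &
      forall i j, partial i (partial j F) y = partial j (partial i F) y].

Lemma is_derive_partial F y (i : 'I_n) : derivable F y (delta_mx 0 i) ->
  is_derive y (delta_mx 0 i) F (partial i F y).
Proof. exact: derivableP. Qed.

Lemma partial_val F y (i : 'I_n) a : is_derive y (delta_mx 0 i) F a -> partial i F y = a.
Proof. by case. Qed.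

Lemma smooth_twice_derivable F : smooth_on U F -> twice_derivable_on F.
Proof.
move=> sF y Uy; split=> [i|i j|i j].
- exact: (sF [::] y Uy).2.
- exact: (sF [:: i] y Uy).2.
- apply: derive_commute.
  + apply: filterS (open_nbhs_nbhs (conj oU Uy)) => z Uz; split.
    * exact: (sF [::] z Uz).2.
    * exact: (sF [::] z Uz).2.
    * exact: (sF [:: j] z Uz).2.
    * exact: (sF [:: i] z Uz).2.
  + exact: (sF [:: i; j] y Uy).1.
  + exact: (sF [:: j; i] y Uy).1.
Qed.

Local Opaque partial.

Lemma product_rule_sym (a b ai aj bi bj aij bij : R) :
  a * bij + bi * aj + (b * aij + ai * bj) = a * bij + bj * ai + (b * aij + aj * bi).
Proof. by ring. Qed.

Lemma twice_derivable_mul F H : twice_derivable_on F -> twice_derivable_on H ->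
  twice_derivable_on (fun y => F y * H y).
Proof.
move=> dF dH.
have d1 y i : U y -> is_derive y (delta_mx 0 i) (fun y => F y * H y)
    (F y * partial i H y + H y * partial i F y).
  move=> Uy; have [dF1 _ _] := dF y Uy; have [dH1 _ _] := dH y Uy.
  by apply: is_derive_mul; exact: is_derive_partial.
have d2 y i j : U y -> is_derive y (delta_mx 0 j)
    (fun z => F z * partial i H z + H z * partial i F z)
    (F y * partial j (partial i H) y + partial i H y * partial j F y
     + (H y * partial j (partial i F) y + partial i F y * partial j H y)).
  move=> Uy; have [dF1 dF2 _] := dF y Uy; have [dH1 dH2 _] := dH y Uy.
  by apply: is_derive_add; apply: is_derive_mul; apply: is_derive_partial.
have d1E i z : U z -> F z * partial i H z + H z * partial i F z
    = partial i (fun y => F y * H y) z.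
  by move=> Uz; rewrite (partial_val (d1 z i Uz)).
move=> y Uy; have [_ _ sF] := dF y Uy; have [_ _ sH] := dH y Uy; split.
- by move=> i; case: (d1 y i Uy).
- by move=> i j; apply: (derivable_eq_on (d1E i) Uy); case: (d2 y i j Uy).
- move=> i j; rewrite -(partial_eq_on _ (d1E i) Uy) -(partial_eq_on _ (d1E j) Uy).
  rewrite (partial_val (d2 y i j Uy)) (partial_val (d2 y j i Uy)) (sF i j) (sH i j).
  exact: product_rule_sym.
Qed.

Lemma is_derive_exp2 F y i : derivable F y (delta_mx 0 i) ->
  is_derive y (delta_mx 0 i) (fun z => expR (2 * F z))
    (expR (2 * F y) * (2 * partial i F y)).
Proof.
move=> dF; apply: is_derive_expR_comp; apply: is_derive_scal.
exact: is_derive_partial.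
Qed.

Lemma twice_derivable_exp2 F : twice_derivable_on F ->
  twice_derivable_on (fun y => expR (2 * F y)).
Proof.
move=> dF.
have d1 y i : U y -> is_derive y (delta_mx 0 i) (fun y => expR (2 * F y))
    (expR (2 * F y) * (2 * partial i F y)).
  by move=> Uy; have [dF1 _ _] := dF y Uy; exact: is_derive_exp2.
have d2 y i j : U y -> is_derive y (delta_mx 0 j)
    (fun z => expR (2 * F z) * (2 * partial i F z))
    (expR (2 * F y) * (2 * partial j (partial i F) y)
     + 2 * partial i F y * (expR (2 * F y) * (2 * partial j F y))).
  move=> Uy; have [dF1 dF2 _] := dF y Uy; apply: is_derive_mul; first exact: d1.
  by apply: is_derive_scal; apply: is_derive_partial.
have d1E i z : U z -> expR (2 * F z) * (2 * partial i F z)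
    = partial i (fun y => expR (2 * F y)) z.
  by move=> Uz; rewrite (partial_val (d1 z i Uz)).
move=> y Uy; have [_ _ sF] := dF y Uy; split.
- by move=> i; case: (d1 y i Uy).
- by move=> i j; apply: (derivable_eq_on (d1E i) Uy); case: (d2 y i j Uy).
- move=> i j; rewrite -(partial_eq_on _ (d1E i) Uy) -(partial_eq_on _ (d1E j) Uy).
  by rewrite (partial_val (d2 y i j Uy)) (partial_val (d2 y j i Uy)) (sF i j); ring.
Qed.

Definition regular_metric G : Prop :=
  [/\ forall y, U y -> (G y)^T = G y, forall y, U y -> G y \in unitmx &
      forall i j, twice_derivable_on (fun y => G y i j)].

Lemma regular_metric_conformal F G : twice_derivable_on F -> regular_metric G ->
  regular_metric (fun y => expR (2 * F y) *: G y).
Proof.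
move=> dF [Gsym Gunit dG]; split=> [y Uy|y Uy|i j].
- by rewrite linearZ /= Gsym.
- rewrite unitmxZ; first exact: Gunit.
  by rewrite unitfE gt_eqF // expR_gt0.
- have -> : (fun y => (expR (2 * F y) *: G y) i j) = (fun y => expR (2 * F y) * G y i j).
    by apply/funext => y; rewrite mxE.
  exact: (twice_derivable_mul (twice_derivable_exp2 dF) (dG i j)).
Qed.

End Open_set.

(** * Curvature through Christoffel symbols of the first kind *)

Section Bilinear_forms.
Variables (R : realType) (n : nat).
Implicit Types (B G : 'M[R]_n) (u v w : 'rV[R]_n).

Lemma form_ofDl B u v w : form_of B (u + v) w = form_of B u w + form_of B v w.
Proof. by rewrite /form_of !mulmxDl mxE. Qed.

Lemma form_ofBl B u v w : form_of B (u - v) w = form_of B u w - form_of B v w.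
Proof. by rewrite /form_of !mulmxBl !mxE. Qed.

Lemma form_ofZl B a u w : form_of B (a *: u) w = a * form_of B u w.
Proof. by rewrite /form_of -!scalemxAl mxE. Qed.

Lemma form_of_scale B a b u v :
  form_of (a *: B) (b *: u) (b *: v) = a * b * b * form_of B u v.
Proof.
have vT : (b *: v)^T = b *: v^T by apply/matrixP => i j; rewrite !mxE.
rewrite /form_of vT.
rewrite !(=^~ scalemxAl, =^~ scalemxAr) !scalerA mxE; congr (_ * _).
by ring.
Qed.

Lemma form_of_sym B u v : B^T = B -> form_of B u v = form_of B v u.
Proof.
by move=> Bsym; rewrite /form_of -[RHS]trace_mx11 -mxtrace_tr !trmx_mul trmxK Bsym
  mulmxA trace_mx11.
Qed.

Lemma form_of_inv_row G u (a : 'I_n) : G^T = G -> G \in unitmx ->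
  form_of (invmx G) (row a G) u = u 0 a.
Proof.
move=> Gsym uG; rewrite /form_of rowE -(mulmxA _ G) mulmxV // mulmx1.
by rewrite -rowE !mxE.
Qed.

Lemma invmx_sym G : G^T = G -> (invmx G)^T = invmx G.
Proof. by move=> Gsym; rewrite trmx_inv Gsym. Qed.

End Bilinear_forms.

Section Curvature_first_kind.
Variables (R : realType) (n : nat) (U : set 'rV[R]_n).
Hypothesis oU : open U.
Variable G : 'rV[R]_n -> 'M[R]_n.
Hypothesis rG : regular_metric U G.
Implicit Types (y : 'rV[R]_n) (i j k l m : 'I_n).

Let Gsym y : U y -> (G y)^T = G y. Proof. by case: rG => + _ _; apply. Qed.
Let Gunit y : U y -> G y \in unitmx. Proof. by case: rG => _ + _; apply. Qed.
Let GsymE y i j : U y -> G y i j = G y j i.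
Proof. by move=> Uy; rewrite -{1}(Gsym Uy) mxE. Qed.

(** The lowered index comes first, in the place of the upper one. *)
Definition christoffel_first (H : 'rV[R]_n -> 'M[R]_n) k i j y : R :=
  2^-1 * (partial i (fun z => H z j k) y + partial j (fun z => H z i k) y
          - partial k (fun z => H z i j) y).

Definition christoffel_row (H : 'rV[R]_n -> 'M[R]_n) i j y : 'rV[R]_n :=
  \row_k christoffel_first H k i j y.

Lemma christoffelE (H : 'rV[R]_n -> 'M[R]_n) k i j y :
  christoffel H k i j y = \sum_l invmx (H y) k l * christoffel_first H l i j y.
Proof.
by rewrite /christoffel mulr_sumr; apply: eq_bigr => l _; rewrite mulrCA.
Qed.

Local Opaque partial.

Lemma partial_sym y i j k : U y ->
  partial k (fun z => G z i j) y = partial k (fun z => G z j i) y.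
Proof. by move=> Uy; apply: (partial_eq_on oU) Uy => z; exact: GsymE. Qed.

Lemma christoffel_first_sym k i j y : U y ->
  christoffel_first G k i j y = christoffel_first G k j i y.
Proof.
by move=> Uy; rewrite /christoffel_first (partial_sym i j k Uy) (addrC (partial i _ _)).
Qed.

Lemma sum_christoffel i j y (v : 'rV[R]_n) : U y ->
  \sum_m christoffel G m i j y * v 0 m
  = form_of (invmx (G y)) (christoffel_row G i j y) v.
Proof.
move=> Uy; rewrite /form_of mxE; apply: eq_bigr => m _.
rewrite [v^T _ _]mxE; congr (_ * _); rewrite christoffelE mxE.
apply: eq_bigr => l _; rewrite [christoffel_row _ _ _ _ _ _]mxE mulrC.
by rewrite -[in RHS](invmx_sym (Gsym Uy)) [(_^T) _ _]mxE.
Qed.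

Lemma christoffel_lower i j k y : U y ->
  \sum_m christoffel G m i j y * G y m k = christoffel_first G k i j y.
Proof.
move=> Uy; transitivity (\sum_m christoffel G m i j y * row k (G y) 0 m).
  by apply: eq_bigr => m _; rewrite mxE GsymE.
rewrite sum_christoffel // form_of_sym ?invmx_sym ?Gsym //.
by rewrite form_of_inv_row ?Gsym ?Gunit // mxE.
Qed.

(** Compatibility of the connection with the metric. *)
Lemma partial_metric i j k y : U y ->
  partial i (fun z => G z j k) y
  = christoffel_first G k i j y + christoffel_first G j i k y.
Proof.
move=> Uy; rewrite /christoffel_first (partial_sym k j i Uy).
move: (partial _ _ _) (partial _ _ _) (partial _ _ _) => a b c.
by field.
Qed.

Lemma is_derive_christoffel_first i k j l y : U y ->
  is_derive y (delta_mx 0 i) (christoffel_first G k j l)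
    (2^-1 * (partial i (partial j (fun z => G z l k)) y
             + partial i (partial l (fun z => G z j k)) y
             - partial i (partial k (fun z => G z j l)) y)).
Proof.
case: rG => _ _ dG Uy.
have d a b c : is_derive y (delta_mx 0 i) (partial c (fun z => G z a b))
    (partial i (partial c (fun z => G z a b)) y).
  by apply: is_derive_partial; have [_ dG2 _] := dG a b y Uy; exact: dG2.
exact: (is_derive_scal _ (is_derive_sub (is_derive_add (d _ _ _) (d _ _ _)) (d _ _ _))).
Qed.

Lemma derivable_christoffel m i j k y : U y ->
  derivable (christoffel G m i j) y (delta_mx 0 k).
Proof.
move=> Uy.
have -> : christoffel G m i j
    = fun z => \sum_l invmx (G z) m l * christoffel_first G l i j z.
  by apply/funext => z; exact: christoffelE.
apply: derivable_bigsum => l; apply: derivable_mul.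
  case: rG => _ _ dG; apply: derivable_invmx.
    by apply: filterS (open_nbhs_nbhs (conj oU Uy)) => z; exact: Gunit.
  by move=> a b; have [dG1 _ _] := dG a b y Uy; exact: dG1.
by case: (is_derive_christoffel_first k l i j Uy).
Qed.

(** Leibniz rule applied to [christoffel_lower], the derivative of the metric
    being expressed by [partial_metric]. *)
Lemma lower_partial_christoffel i j l k y : U y ->
  \sum_m partial i (christoffel G m j l) y * G y m k
  = partial i (christoffel_first G k j l) y
    - \sum_m christoffel G m j l y * christoffel_first G k i m y
    - form_of (invmx (G y)) (christoffel_row G j l y) (christoffel_row G i k y).
Proof.
move=> Uy; have [_ _ dG] := rG.
have dS : is_derive y (delta_mx 0 i) (fun z => \sum_m christoffel G m j l z * G z m k)
    (\sum_m (christoffel G m j l y * partial i (fun z => G z m k) y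
             + G y m k * partial i (christoffel G m j l) y)).
  apply: is_derive_bigsum => m; have [dG1 _ _] := dG m k y Uy.
  have dGam := is_derive_partial (@derivable_christoffel m j l i y Uy).
  exact: (is_derive_mul dGam (is_derive_partial (dG1 i))).
have -> : partial i (christoffel_first G k j l) y
    = partial i (fun z => \sum_m christoffel G m j l z * G z m k) y.
  by apply: (partial_eq_on oU) Uy => z Uz; rewrite christoffel_lower.
rewrite (partial_val dS) -sum_christoffel // -!sumrB; apply: eq_bigr => m _.
rewrite partial_metric // [christoffel_row _ _ _ _ _ _]mxE.
move: (partial _ _ _) (christoffel _ _ _ _ _) (christoffel_first _ _ _ _ _)
  (christoffel_first _ _ _ _ _) (G y m k) => a b c d e.
by ring.
Qed.

(** In each product of two symbols, one half of the term produced by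
    [lower_partial_christoffel] cancels the quadratic part of [curvature_op];
    the other half survives with the opposite sign. *)
Lemma riemann_first_kind i j k l y : U y ->
  riemann_coord G i j k l y
  = partial i (christoffel_first G k j l) y - partial j (christoffel_first G k i l) y
    - form_of (invmx (G y)) (christoffel_row G j l y) (christoffel_row G i k y)
    + form_of (invmx (G y)) (christoffel_row G i l y) (christoffel_row G j k y).
Proof.
move=> Uy; pose Gam m a b := christoffel G m a b y.
have quad a b : \sum_m (\sum_s Gam s b l * Gam m a s) * G y m k
    = \sum_s Gam s b l * christoffel_first G k a s y.
  under eq_bigr do rewrite mulr_suml.
  rewrite exchange_big; apply: eq_bigr => s _ /=.
  rewrite -christoffel_lower // mulr_sumr; apply: eq_bigr => m _.
  by rewrite mulrA.
have curv : riemann_coord G i j k l y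
  = \sum_m partial i (christoffel G m j l) y * G y m k
    - \sum_m partial j (christoffel G m i l) y * G y m k
    + \sum_m (\sum_s Gam s j l * Gam m i s) * G y m k
    - \sum_m (\sum_s Gam s i l * Gam m j s) * G y m k.
  rewrite /riemann_coord -sumrB -big_split -sumrB; apply: eq_bigr => m _ /=.
  rewrite /curvature_op sumrB /Gam.
  move: (partial _ _ _) (partial _ _ _) (\sum_s _) (\sum_s _) (G y m k) => a b c d e.
  by ring.
have combine (r s1 s2 q1 q2 a1 a2 c1 c2 f1 f2 : R) :
    r = s1 - s2 + q1 - q2 -> s1 = a1 - c1 - f1 -> s2 = a2 - c2 - f2 ->
    q1 = c1 -> q2 = c2 -> r = a1 - a2 - f1 + f2.
  by move=> -> -> -> -> ->; ring.
exact: (combine _ _ _ _ _ _ _ _ _ _ _ curv (lower_partial_christoffel i j l k Uy)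
  (lower_partial_christoffel j i l k Uy) (quad i j) (quad j i)).
Qed.

(** Antisymmetry in the first pair is visible.  In the second pair, the
    quadratic terms are exchanged, and the second derivatives of [g] reduce to
    four antisymmetric ones because the remaining two are mixed derivatives of
    the same component. *)
Lemma riemann_antisym y : U y ->
  antisym_pairs (fun i j k l => riemann_coord G i j k l y).
Proof.
move=> Uy; split=> i j k l; rewrite !riemann_first_kind //.
  move: (partial _ _ _) (partial _ _ _) (form_of _ _ _) (form_of _ _ _) => a b c d.
  by ring.
have [_ _ dG] := rG.
have Ginv := invmx_sym (Gsym Uy).
rewrite (form_of_sym (christoffel_row G j k y) _ Ginv).
rewrite (form_of_sym (christoffel_row G i k y) _ Ginv).
have dc a b c d := partial_val (is_derive_christoffel_first a b c d Uy).
rewrite (dc i k j l) (dc j k i l) (dc i l j k) (dc j l i k).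
have [_ _ cG] := dG l k y Uy.
have swap a b : partial a (partial b (fun z => G z k l)) y
    = partial a (partial b (fun z => G z l k)) y.
  by apply: (partial_eq_on oU) Uy => z Uz; exact: partial_sym.
rewrite (swap i j) (swap j i) (cG i j).
move: (partial _ _ _) (partial _ _ _) (partial _ _ _) (partial _ _ _) (partial _ _ _)
 (form_of _ _ _) (form_of _ _ _) => a b c d e f h.
by field.
Qed.

End Curvature_first_kind.

(** * Conformal change of the curvature tensor *)

Section Conformal_change.
Variables (R : realType) (n : nat) (U : set 'rV[R]_n).
Hypothesis oU : open U.
Variables (G : 'rV[R]_n -> 'M[R]_n) (F : 'rV[R]_n -> R).
Hypotheses (rG : regular_metric U G) (dF : twice_derivable_on U F).
Implicit Types (y : 'rV[R]_n) (i j k l : 'I_n).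

Let Gb z := expR (2 * F z) *: G z.
Let Gsym y : U y -> (G y)^T = G y. Proof. by case: rG => + _ _; apply. Qed.
Let Gunit y : U y -> G y \in unitmx. Proof. by case: rG => _ + _; apply. Qed.
Let GsymE y : U y -> forall i j, G y i j = G y j i.
Proof. by move=> Uy i j; rewrite -{1}(Gsym Uy) mxE. Qed.

Definition partial_row (H : 'rV[R]_n -> R) y : 'rV[R]_n := \row_k partial k H y.

(** The difference of the Christoffel symbols of the first kind, up to the
    factor [e^(2F)]: see [conformal_christoffel_first]. *)
Definition conformal_shift y i j : 'rV[R]_n :=
  partial i F y *: row j (G y) + partial j F y *: row i (G y)
  - G y i j *: partial_row F y.

(** The tensor [A] such that the curvature changes by the Kulkarni-Nomizu
    product of the metric with [A]. *)
Definition schouten y : 'M[R]_n :=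
  hessian_mx G F y - (partial_row F y)^T *m partial_row F y
  + (form_of (invmx (G y)) (partial_row F y) (partial_row F y) / 2) *: G y.

Local Opaque partial.

Lemma conformal_shiftE y i j k : conformal_shift y i j 0 k
  = partial i F y * G y j k + partial j F y * G y i k - partial k F y * G y i j.
Proof. by rewrite !mxE [G y i j * _]mulrC. Qed.

Lemma schoutenE y i j : U y -> schouten y i j
  = partial i (partial j F) y
    - form_of (invmx (G y)) (christoffel_row G i j y) (partial_row F y)
    - partial i F y * partial j F y
    + form_of (invmx (G y)) (partial_row F y) (partial_row F y) / 2 * G y i j.
Proof.
move=> Uy; rewrite -(sum_christoffel rG) // !mxE big_ord1 !mxE; congr (_ - _ - _ + _).
by apply: eq_bigr => m _; rewrite mxE.
Qed.

Lemma is_derive_conformal i j k y : U y ->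
  is_derive y (delta_mx 0 i) (fun z => Gb z j k)
   (expR (2 * F y) * partial i (fun z => G z j k) y
    + G y j k * (expR (2 * F y) * (2 * partial i F y))).
Proof.
move=> Uy; have [dF1 _ _] := dF Uy; case: rG => _ _ dG; have [dG1 _ _] := dG j k y Uy.
have -> : (fun z => Gb z j k) = fun z => expR (2 * F z) * G z j k.
  by apply/funext => z; rewrite mxE.
exact: (is_derive_mul (is_derive_exp2 (dF1 i)) (is_derive_partial (dG1 i))).
Qed.

Lemma conformal_christoffel_first k i j y : U y ->
  christoffel_first Gb k i j y
  = expR (2 * F y) * (christoffel_first G k i j y + conformal_shift y i j 0 k).
Proof.
move=> Uy; have d a b c := partial_val (is_derive_conformal a b c Uy).
rewrite {1}/christoffel_first (d i j k) (d j i k) (d k i j) conformal_shiftE.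
rewrite /christoffel_first.
move: (partial i F y) (partial j F y) (partial k F y) (partial i _ y)
  (partial j _ y) (partial k _ y) (expR _) (G y j k) (G y i k) (G y i j)
  => fi fj fk a b c w p q r.
by field.
Qed.

Lemma conformal_christoffel_row i j y : U y ->
  christoffel_row Gb i j y
  = expR (2 * F y) *: (christoffel_row G i j y + conformal_shift y i j).
Proof.
move=> Uy; apply/rowP => k; rewrite [LHS]mxE conformal_christoffel_first //.
by rewrite [RHS]mxE [in RHS]mxE [christoffel_row _ _ _ _ _ _]mxE.
Qed.

Lemma partial_conformal_christoffel i k j l y : U y ->
  partial i (christoffel_first Gb k j l) y
  = expR (2 * F y) *
    (partial i (christoffel_first G k j l) y
     + (partial j F y * partial i (fun z => G z l k) y
        + G y l k * partial i (partial j F) y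
        + (partial l F y * partial i (fun z => G z j k) y
           + G y j k * partial i (partial l F) y)
        - (partial k F y * partial i (fun z => G z j l) y
           + G y j l * partial i (partial k F) y)))
    + (christoffel_first G k j l y + conformal_shift y j l 0 k)
      * (expR (2 * F y) * (2 * partial i F y)).
Proof.
move=> Uy.
have cE z : U z -> christoffel_first Gb k j l z
  = expR (2 * F z) * (christoffel_first G k j l z
     + (partial j F z * G z l k + partial l F z * G z j k - partial k F z * G z j l)).
  by move=> Uz; rewrite conformal_christoffel_first // conformal_shiftE.
rewrite (partial_eq_on oU i cE Uy).
have [dF1 dF2 _] := dF Uy; case: (rG) => _ _ dG.
have dFG a b c : is_derive y (delta_mx 0 i) (fun z => partial a F z * G z b c)
   (partial a F y * partial i (fun z => G z b c) y + G y b c * partial i (partial a F) y).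
  have [dG1 _ _] := dG b c y Uy.
  exact: (is_derive_mul (is_derive_partial (dF2 a i)) (is_derive_partial (dG1 i))).
have [dc _] := is_derive_christoffel_first rG i k j l Uy.
have dsum := is_derive_add (is_derive_partial dc)
  (is_derive_sub (is_derive_add (dFG j l k) (dFG l j k)) (dFG k j l)).
rewrite (partial_val (is_derive_mul (is_derive_exp2 (dF1 i)) dsum)).
by rewrite conformal_shiftE.
Qed.

(** Both sides are expanded by [riemann_first_kind].  The inverse metric occurs
    only in pairings of covectors, where a row of [G] is contracted to a single
    component; what remains is a polynomial identity in the components. *)
Lemma conformal_riemann i j k l y : U y ->
  riemann_coord Gb i j k l y
  = expR (2 * F y) *
    (riemann_coord G i j k l y - kulkarni_nomizu (G y) (schouten y) i j k l).
Proof.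
move=> Uy; set w := expR (2 * F y).
have w0 : w != 0 by rewrite gt_eqF // expR_gt0.
have rGb : regular_metric U Gb := regular_metric_conformal oU dF rG.
have gs := GsymE Uy; have Gs := Gsym Uy; have uG := Gunit Uy.
have Is := invmx_sym Gs.
set f := partial_row F y; set N := invmx (G y) in Is *.
pose P a b := form_of N (christoffel_row G a b y) f.
pose q := form_of N f f.
have fE a : f 0 a = partial a F y by rewrite mxE.
have shiftf a b (v : 'rV[R]_n) : form_of N (conformal_shift y a b) v
    = f 0 a * v 0 b + f 0 b * v 0 a - G y a b * form_of N f v.
  by rewrite form_ofBl form_ofDl !form_ofZl !form_of_inv_row // !fE.
(* Pairings of the new symbols; the factor is [w^-1 * w * w]. *)
have quad a b c d :
   form_of (invmx (Gb y)) (christoffel_row Gb a b y) (christoffel_row Gb c d y)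
   = w * (form_of N (christoffel_row G a b y) (christoffel_row G c d y)
       + (f 0 c * christoffel_first G d a b y + f 0 d * christoffel_first G c a b y
          - G y c d * P a b)
       + (f 0 a * (christoffel_first G b c d y + conformal_shift y c d 0 b)
          + f 0 b * (christoffel_first G a c d y + conformal_shift y c d 0 a)
          - G y a b * (P c d + (f 0 c * f 0 d + f 0 d * f 0 c - G y c d * q)))).
  rewrite !conformal_christoffel_row // -/w invmxZ; last by rewrite unitmxZ ?unitfE.
  rewrite form_of_scale -/N mulVf // mul1r; congr (_ * _).
  rewrite form_ofDl shiftf form_of_sym // form_ofDl shiftf.
  rewrite (form_of_sym _ _ Is) (form_of_sym f _ Is) (form_of_sym f _ Is).
  rewrite form_ofDl shiftf -/(P a b) -/(P c d) -/q.
  by rewrite ![(_ + _ : 'rV_n) 0 _]mxE ![christoffel_row _ _ _ _ _ _]mxE.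
rewrite (riemann_first_kind oU rGb) // (riemann_first_kind oU rG) //.
rewrite (quad j l i k) (quad i l j k) -/N.
rewrite (partial_conformal_christoffel i k j l Uy).
rewrite (partial_conformal_christoffel j k i l Uy) -/w.
rewrite /kulkarni_nomizu !schoutenE // -/f -/N -/q.
clear quad shiftf.
rewrite -/(P j l) -/(P i k) -/(P j k) -/(P i l) !conformal_shiftE !fE.
have dg a b c := partial_metric oU rG a b c Uy.
rewrite (dg i l k) (dg i j k) (dg i j l) (dg j l k) (dg j i k) (dg j i l).
have cs a b c := christoffel_first_sym oU rG a b c Uy.
have [_ _ Fs] := dF Uy.
rewrite (gs l k) (gs k j) (gs k i) (gs j i) (cs k j i) (cs l j i) (Fs j i).
(* All symmetries have been used to normalise the indices: the rest holds for
   arbitrary scalars. *)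
move: (partial i (christoffel_first _ _ _ _) y) (partial j (christoffel_first _ _ _ _) y).
move: (partial i (partial j F) y) (partial i (partial k F) y) (partial i (partial l F) y)
  (partial j (partial k F) y) (partial j (partial l F) y).
move: (partial i F y) (partial j F y) (partial k F y) (partial l F y).
clearbody q P w.
move: (P j l) (P i k) (P j k) (P i l) q.
move: (form_of N _ _) (form_of N _ _).
move: (christoffel_first G k j l y) (christoffel_first G k i l y)
  (christoffel_first G l i k y) (christoffel_first G l j k y)
  (christoffel_first G i j l y) (christoffel_first G i j k y)
  (christoffel_first G j i k y) (christoffel_first G j i l y)
  (christoffel_first G k i j y) (christoffel_first G l i j y).
move: (G y k l) (G y j k) (G y i k) (G y i j) (G y j l) (G y i l).
clear -w.
move=> g1 g2 g3 g4 g5 g6 c1 c2 c3 c4 c5 c6 c7 c8 c9 c10 q1 q2 p1 p2 p3 p4 q.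
move=> fi fj fk fl fij fik fil fjk fjl d1 d2.
by field.
Qed.

End Conformal_change.

(** * Invariants in an orthonormal frame *)

Section Frame_expressions.
Variables (R : realType) (n : nat) (M : topologicalType).
Implicit Types (g : form_field R n M) (c : chart R n M) (p : M).

Definition curvature_components g c p (i j k l : 'I_n) : R :=
  riemann_coord (in_chart c (g c)) i j k l (chart_map c p).

Definition onb_curvature g c p :=
  frame_components (curvature_components g c p) (orthonormal_basis (g c p)).

Lemma ricci_onb g c p (a b : 'I_n) :
  ricci g c p (onb g c p a) (onb g c p b) = ricci_contraction (onb_curvature g c p) a b.
Proof. by []. Qed.

Lemma h4E g c p : antisym_pairs (curvature_components g c p) ->
  h4 g c p = gauss_bonnet4 (onb_curvature g c p).
Proof.
move=> cA; rewrite /gauss_bonnet4 -sum_sqr_ordered_pairs //.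
exact: frame_antisym.
Qed.

Lemma form_of_mul (B E : 'M[R]_n) (u v : 'rV[R]_n) :
  form_of B (u *m E) (v *m E) = form_of (E *m B *m E^T) u v.
Proof. by rewrite /form_of trmx_mul !mulmxA. Qed.

(** Each term of the operator in frame components; the gradient has the same
    components as the differential since the frame is orthonormal. *)
Lemma conformal_operatorE g (f : M -> R) c p :
  let E := orthonormal_basis (g c p) in
  let S := E *m Hess g f c p *m E^T in
  let u := differential f c p *m E^T in
  let r := onb_curvature g c p in
  let N : R := n%:R in
  let q := \sum_a u 0 a ^+ 2 in
  let sc := \sum_j ricci_contraction r j j in
  E *m g c p *m E^T = 1%:M -> (Hess g f c p)^T = Hess g f c p ->
  conformal_operator g f c p
  = (N - 2) * (N - 3) * ((\tr S) ^+ 2 - \tr (S *m S))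
    - 2 * (N - 3) * (sc / 2 * \tr S - \sum_j \sum_l ricci_contraction r j l * S j l)
    + (N - 2) * (N - 3) ^+ 2 * \tr S * q
    + 2 * (N - 2) * (N - 3) * form_of S u u
    + 2 * (N - 3) * (sc / 2 * q
        - \sum_j \sum_l u 0 j * u 0 l * ricci_contraction r j l)
    - (N - 2) * (N - 3) * (sc / 2) * q
    + (N - 1) * (N - 2) * (N - 3) * (N - 4) / 4 * q ^+ 2.
Proof.
move=> E S u r N q sc EG Hsym.
have [uG Ginv] := invmx_orthonormal EG.
have gradE : gradient g f c p = u *m E by rewrite /gradient Ginv mulmxA.
have dfE : differential_sqnorm g f c p = q.
  apply: eq_bigr => a _; congr (_ ^+ 2).
  by rewrite /onb tr_row !mxE; apply: eq_bigr => k _; rewrite !mxE.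
have h2E : h2 g c p = sc / 2 by [].
have lapE : Laplacian g f c p = - \tr S.
  by congr (- _); apply: eq_bigr => a _; rewrite form_of_rows.
have ellE : ell2 g f c p
    = - (sc / 2 * \tr S - \sum_j \sum_l ricci_contraction r j l * S j l).
  congr (- _); rewrite mulr_sumr -sumrB; apply: eq_bigr => a _.
  transitivity (\sum_b ((b == a)%:R * (sc / 2 * S a b)
                         - ricci_contraction r a b * S a b)).
    apply: eq_bigr => b _; rewrite /T2 h2E ricci_onb !form_of_rows EG.
    rewrite [1%:M _ _]mxE eq_sym -/S -/r; ring.
  by rewrite sumrB sum_delta.
have hessE : form_of (Hess g f c p) (gradient g f c p) (gradient g f c p) = form_of S u u.
  by rewrite gradE form_of_mul.
have T2E : T2 g c p (gradient g f c p) (gradient g f c p)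
    = sc / 2 * q - \sum_j \sum_l u 0 j * u 0 l * ricci_contraction r j l.
  rewrite /T2 h2E gradE form_of_mul EG; congr (_ * _ - _).
    by rewrite /form_of mulmx1 mxE; apply: eq_bigr => a _; rewrite [u^T _ _]mxE expr2.
  rewrite /ricci ricci_eval form_of_mul form_ofE.
  by do 2!(apply: eq_bigr => ? _); rewrite ricci_frame.
have sigE := sigma2E Hsym EG.
rewrite /conformal_operator hessE T2E ellE lapE dfE h2E -/S -/N.
have -> : 2 * (N - 2) * (N - 3) * sigma2_Hess g f c p
    = (N - 2) * (N - 3) * ((\tr S) ^+ 2 - \tr (S *m S)).
  by rewrite -sigE /sigma2_Hess; ring.
ring.
Qed.

End Frame_expressions.

(** * Conformal change of the second Gauss-Bonnet curvature *)

Theorem theorem4p3 (R : realType) (n : nat) (hn : (4 <= n)%N)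
    (M : topologicalType) (A : set (chart R n M)) (hM : smooth_manifold A)
    (g : form_field R n M) (hg : riemannian_metric A g)
    (f : M -> R) (hf : smooth_function A f)
    (c : chart R n M) (hc : A c) (p : M) (hp : chart_dom c p) :
  expR (4 * f p) * h4 (conformal f g) c p
  = h4 g c p + conformal_operator g f c p.
Proof.
have [_ _ charts _ _] := hM; have [_ oU chartK _ _] := charts c hc.
have [gsmooth gsym gpos _] := hg.
set U := chart_cod c in oU; set x := chart_map c p.
have Ux : U x by exists p.
have xK : chart_inv c x = p by exact: chartK.
pose G := in_chart c (g c); pose F := in_chart c f.
have Gx : G x = g c p by rewrite /G /in_chart xK.
have Fx : F x = f p by rewrite /F /in_chart xK.
have orth q : chart_dom c q ->
    orthonormal_basis (g c q) *m g c q *m (orthonormal_basis (g c q))^T = 1%:M.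
  by move=> dq; apply: orthonormal_basisP; [exact: gsym | exact: gpos].
have rG : regular_metric U G.
  split=> [_ [q dq <-]|_ [q dq <-]|i j].
  - by rewrite /G /in_chart chartK // gsym.
  - by rewrite /G /in_chart chartK //; case: (invmx_orthonormal (orth q dq)).
  - exact: (smooth_twice_derivable oU (gsmooth c hc i j)).
have dF : twice_derivable_on U F := smooth_twice_derivable oU (hf c hc).
have rGb := regular_metric_conformal oU dF rG.
pose E := orthonormal_basis (g c p); have EG : E *m g c p *m E^T = 1%:M := orth p hp.
have w0 : 0 < expR (2 * f p) := expR_gt0 _.
pose E' := orthonormal_basis (conformal f g c p).
have E'G : E' *m (conformal f g c p) *m E'^T = 1%:M.
  apply: orthonormal_basisP; first by rewrite /conformal linearZ /= gsym.
  move=> v v0; rewrite /conformal -scalemxAr -scalemxAl mxE mulr_gt0 //.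
  exact: gpos.
(* A frame orthonormal for [g], so comparable with [E], unlike [E']. *)
pose E2 := expR (f p) *: E'.
have E2G : E2 *m g c p *m E2^T = 1%:M.
  pose t := expR (f p).
  have wE : expR (2 * f p) = t * t by rewrite mulr_natl mulr2n expRD.
  have ET : E2^T = t *: E'^T by apply/matrixP => i j; rewrite !mxE.
  rewrite ET /E2 -/t -E'G /conformal wE.
  by rewrite !(=^~ scalemxAl, =^~ scalemxAr) !scalerA.
pose H := Hess g f c p.
have Hsym : H^T = H.
  have [_ _ Fs] := dF x Ux.
  apply/matrixP => i j; rewrite !mxE (Fs j i); congr (_ - _).
  apply: eq_bigr => k _; congr (_ * _); rewrite !christoffelE.
  by apply: eq_bigr => l _; rewrite (christoffel_first_sym oU rG _ _ _ Ux).
pose T0 i j k l := curvature_components g c p i j k l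
  - kulkarni_nomizu (g c p) (schouten G F x) i j k l.
have conf i j k l : curvature_components (conformal f g) c p i j k l
    = expR (2 * f p) * T0 i j k l.
  by rewrite /T0 -Gx -Fx; exact: (conformal_riemann oU rG dF i j k l Ux).
have cA : antisym_pairs (curvature_components g c p) := riemann_antisym oU rG Ux.
have cbA : antisym_pairs (curvature_components (conformal f g) c p)
  := riemann_antisym oU rGb Ux.
set r := onb_curvature g c p.
have rA : antisym_pairs r := frame_antisym E cA.
pose S := E *m H *m E^T; pose u := differential f c p *m E^T.
have Ssym : S^T = S by rewrite /S !trmx_mul trmxK Hsym mulmxA.
have [uG Ginv] := invmx_orthonormal EG; have [_ Ginv2] := invmx_orthonormal E2G.
pose q := \sum_a u 0 a ^+ 2.
have qE : form_of (invmx (g c p)) (differential f c p) (differential f c p) = q.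
  rewrite /form_of Ginv mulmxA -mulmxA -{2}[E]trmxK -trmx_mul -/u mxE.
  by apply: eq_bigr => a _; rewrite [u^T _ _]mxE expr2.
have schE : E *m schouten G F x *m E^T = S - u^T *m u + (q / 2)%:M.
  rewrite /schouten Gx -/H -[partial_row F x]/(differential f c p) qE.
  rewrite mulmxDr mulmxBr mulmxDl mulmxBl -scalemxAr -scalemxAl EG scalemx1.
  by rewrite /u trmx_mul trmxK !mulmxA.
have frameT0 : frame_components T0 E
    = fun i j k l => r i j k l - kulkarni_nomizu 1%:M (S - u^T *m u + (q / 2)%:M) i j k l.
  apply/funext => a; apply/funext => b; apply/funext => d; apply/funext => e.
  rewrite -schE -EG -frame_kulkarni_nomizu /frame_components.
  by rewrite /T0 tensor_evalB.
(* The exponent is 2 - 4: the curvature is multiplied by [e^(2f)], and each of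
   the four slots by [e^(-f)]. *)
have frameE' : onb_curvature (conformal f g) c p
    = fun i j k l => expR (f p) ^- 2 * frame_components T0 E2 i j k l.
  apply/funext => a; apply/funext => b; apply/funext => d; apply/funext => e.
  rewrite /E2 frame_componentsZ /onb_curvature -/E' /frame_components.
  rewrite (eq_tensor_eval _ _ _ _ conf) tensor_evalZ mulrA; congr (_ * _).
  have t0 : expR (f p) != 0 by rewrite gt_eqF // expR_gt0.
  by rewrite expRM_natl; move: (expR _) t0 => t t0; field.
rewrite (h4E cbA) (h4E cA) frameE' gauss_bonnet4_scale.
rewrite (gauss_bonnet4_frame_indep T0 (E' := E)); last by rewrite -Ginv -Ginv2.
rewrite frameT0 mulrA expRM_natl -[X in X * _]/(expR (f p) ^+ 4 * (expR (f p) ^- 2) ^+ 2).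
have -> : expR (f p) ^+ 4 * (expR (f p) ^- 2) ^+ 2 = 1.
  have t0 : expR (f p) != 0 by rewrite gt_eqF // expR_gt0.
  by move: (expR _) t0 => t t0; field.
rewrite mul1r (gauss_bonnet4_schouten u rA Ssym) (conformal_operatorE EG Hsym).
by rewrite -!addrA.
Qed.
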